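(* Let $G$ be a grid diagram with parameters $(n,p,q)$ representing a knot in $L(p,q)$, and let $\mathbb{F}=\mathbb{Z}/2\mathbb{Z}$. Then the modules $\mathrm{GC}^-(G)$ and $\widehat{\mathrm{GC}}(G)$ endowed with the endomorphism $\partial$ are chain complexes, i.e. $\partial^2=0$ in both cases. Moreover $\partial$ acts on the tri-grading as follows: for every $x\in S(G)$, $\partial(x)$ is homogeneous (or zero), with (1) $S(\partial(x))=S(x)$; (2) $M(\partial(x))=M(x)-1$; (3) $A(\partial(x))=A(x)$.
   Context: **Grid diagrams.** Let $n\ge 1$ and let $p\ge 1$, $q$ be coprime integers with $0<q<p$, or $(p,q)=(1,0)$. Let $T=\mathbb{R}^2/\Lambda$, where $\Lambda$ is the lattice generated by $(pn,0)$ and $(qn,n)$ (equivalently, the rectangle $[0,pn]\times[0,n]$ with left and right sides identified, and $(s,n)\sim(s-qn \bmod pn,0)$); a fundamental domain is $[0,pn)\times[0,n)$. For $1\le l,j\le n$, $\alpha_l\subset T$ is the circle that is the image of the line $\{y=l-1\}$, and $\beta_j\subset T$ is the circle that is the image of the lines $\{x=c\}$, $c\in\mathbb{Z}$, $c\equiv j-1 \pmod n$. Each $\alpha_l$ meets each $\beta_j$ in $p$ points. The row (column) regions are the annuli between consecutive $\alpha$ (resp. $\beta$) circles. A grid diagram $G$ with parameters $(n,p,q)$ is this data with two sets of markings $\mathbb{X}=\{\mathbb{X}_1,\dots,\mathbb{X}_n\}$, $\mathbb{O}=\{\mathbb{O}_1,\dots,\mathbb{O}_n\}$, placed at centres of unit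 squares of $T\setminus(\alpha\cup\beta)$, such that each row and each column contains exactly one $\mathbb{X}$ and one $\mathbb{O}$, and each square contains at most one marking. Joining each $\mathbb{X}$ to the $\mathbb{O}$ in its row, and each $\mathbb{O}$ to the $\mathbb{X}$ in its column (vertical arcs over horizontal ones), gives a link in the lens space $L(p,q)$; $G$ represents a knot if this link has a single component. **Generators.** $S(G)$ is the set of $n$-tuples of points of $\alpha\cap\beta$ with exactly one point on each $\alpha_l$ and one on each $\beta_j$. Identify $S(G)$ with $\mathfrak{S}_n\times\mathbb{Z}_p^n$ ($\mathbb{Z}_p=\mathbb{Z}/p\mathbb{Z}$): $x=(\sigma_x,(a_1,\dots,a_n))$, where the point of $x$ on $\alpha_l$ lies on $\beta_{\sigma_x(l)}$ and equals the image of $(a_l n+\sigma_x(l)-1,\;l-1)$, $0\le a_l\le p-1$. The $a_l$ are the $p$-coordinates of $x$. **Gradings.** For finite sets $A,B\subset\mathbb{R}^2$, $\mathcal{I}(A,B)$ is the number of pairs $((a_1,a_2),(b_1,b_2))\in A\times B$ with $a_1<b_1$ and $a_2<b_2$. For an $n$-tuple $x=\{(c_i,b_i)\}$ in $[0,pn)\times[0,n)$ set $\widetilde{x}=\{(c_i+nqk \bmod np,\;b_i+nk)\;:\;1\le i\le n,\,0\le k\le p-1\}$. Define $d(1,0,0)=0$ and $d(p,q,i)=\frac{pq-(2i+1-p-q)^2}{4pq}+d(q,r,j)$, where $r,j$ are the reductions of $p,i$ modulo $q$ (the last argument is taken modulo $p$, in $\{0,\dots,p-1\}$). Then $$M(x)=\tfrac1p\left[\mathcal{I}(\widetilde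 x,\widetilde x)-\mathcal{I}(\widetilde x,\widetilde{\mathbb{O}})-\mathcal{I}(\widetilde{\mathbb{O}},\widetilde x)+\mathcal{I}(\widetilde{\mathbb{O}},\widetilde{\mathbb{O}})\right]+d(p,q,q-1)+1,$$ $$A(x)=\tfrac1{2p}\left[\mathcal{I}(\widetilde{\mathbb{O}},\widetilde{\mathbb{O}})-\mathcal{I}(\widetilde{\mathbb{X}},\widetilde{\mathbb{X}})+2\mathcal{I}(\widetilde{\mathbb{X}},\widetilde x)-2\mathcal{I}(\widetilde{\mathbb{O}},\widetilde x)\right]+\tfrac{1-n}2,$$ $$S(x)=q-1+\sum_{i=1}^n(a_i-a_i^{\mathbb{O}})\in\mathbb{Z}_p,$$ where $(a_1^{\mathbb{O}},\dots,a_n^{\mathbb{O}})$ are the $p$-coordinates of the generator consisting of the lower left corners of the squares containing the $\mathbb{O}$ markings. **Rectangles.** For $x,y\in S(G)$, $\mathrm{Rect}(x,y)$ is the set of rectangles $r=[a,a+w]\times[b,b+h]\subset\mathbb{R}^2$ with $a,b\in\mathbb{Z}$ and integers $0<w,h<pn$, up to translation by $\Lambda$ (viewed as immersed rectangles in $T$), such that the lower left and upper right corners project to two distinct points of $x$, the lower right and upper left corners project to two distinct points of $y$, and $x$ and $y$ agree in all other points. $r\in \mathrm{Rect}(x,y)$ is empty, $r\in\mathrm{Rect}^\circ(x,y)$, if no interior point of $r$ projects to a point of $x$. $O_i(r)$ is the number of points of $r$ projecting to $\mathbb{O}_i$, and $r\cap\mathbb{X}=\emptyset$ means no point of $r$ projects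 to an $\mathbb{X}$ marking. **Complexes.** $\mathrm{GC}^-(G)$ is the free module on $S(G)$ over $R=\mathbb{F}[V_1,\dots,V_n]$; $\widehat{\mathrm{GC}}(G)$ is the free module on $S(G)$ over $\widehat R=R/(V_1)$. The gradings extend by $A(V_ix)=A(x)-1$, $M(V_ix)=M(x)-2$, $S(V_ix)=S(x)$ for every $i$. On both modules $\partial$ is the linear endomorphism with $$\partial(x)=\sum_{y\in S(G)}\ \sum_{r\in\mathrm{Rect}^\circ(x,y),\ r\cap\mathbb{X}=\emptyset}\Big(\prod_{i=1}^nV_i^{O_i(r)}\Big)y.$$
   Formalization: A rectangle r in Rect(x,y) is taken to be empty when no interior point of r projects to a point of x or of y; with x alone, immersed rectangles break (2), e.g. for (n,p,q)=(2,3,2). *)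

(* Defs.v *)
From HB Require Import structures.
From mathcomp Require Import all_boot all_order all_algebra all_fingroup.
From mathcomp Require Import ring_quotient mpoly.

Set Implicit Arguments.
Unset Strict Implicit.
Unset Printing Implicit Defensive.

Import Order.TTheory GRing.Theory Num.Theory.
Local Open Scope ring_scope.
Local Open Scope quotient_scope.

(* All indices are shifted to start at 0: the circles alpha_l and beta_j and the
   markings X_i, O_i are indexed by 'I_n, so that alpha_l is y = l and beta_j is
   x = j mod n. *)

Definition lens_params (p q : nat) : Prop :=
  coprime p q /\ ((0 < q < p)%N \/ p = 1%N /\ q = 0%N).

Section Torus.
Variables n p q : nat.

(* The integral vector (u, v) lies in the lattice generated by (pn, 0) and
   (qn, n). *)
Definition in_lattice (u v : int) : bool :=
  (n%:Z %| v)%Z && ((p * n)%:Z %| u - (v %/ n%:Z)%Z * (q * n)%:Z)%Z.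

Lemma in_latticeP (u v : int) :
  reflect (exists s t : int,
             u = s * (p * n)%:Z + t * (q * n)%:Z /\ v = t * n%:Z)
          (in_lattice u v).
Proof.
apply: (iffP andP) => [[/dvdzP[t vE] /dvdzP[s uE]]|[s [t [-> ->]]]].
  exists s, (v %/ n%:Z)%Z; split; first by rewrite -uE subrK.
  by rewrite divzK //; apply/dvdzP; exists t.
split; first exact: dvdz_mull.
have [n0|n0] := eqVneq n 0%N; first by rewrite n0 !muln0 !mulr0 addr0 subr0.
by rewrite mulzK ?addrK ?dvdz_mull // eqz_nat.
Qed.

Definition same_point (P Q : nat * nat) : bool :=
  in_lattice (P.1%:Z - Q.1%:Z) (P.2%:Z - Q.2%:Z).

(* A unit square of the grid, given by the coordinates of its lower left corner
   in the fundamental domain [0, pn) x [0, n). *)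
Definition square : Type := ('I_(p * n) * 'I_n)%type.

Definition corner (s : square) : nat * nat := (val s.1, val s.2).
Definition row (s : square) : nat := s.2.
Definition column (s : square) : nat := (s.1 %% n)%N.

Definition one_per_row_and_column (m : 'I_n -> square) : Prop :=
  (forall l : 'I_n, exists! i : 'I_n, row (m i) = l) /\
  (forall j : 'I_n, exists! i : 'I_n, column (m i) = j).

Record grid : Type := Grid {
  markX : 'I_n -> square;
  markO : 'I_n -> square;
  markX_rowcol : one_per_row_and_column markX;
  markO_rowcol : one_per_row_and_column markO;
  markXO_disjoint : forall i j, markX i <> markO j
}.

(* The arcs of the link: an X marking (inl i) and an O marking (inr j) are
   joined when they share a row or a column.  The components of the link are the
   connected components of this graph. *)
Definition arc (G : grid) : rel ('I_n + 'I_n) := fun u v =>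
  let adj i j := (row (markX G i) == row (markO G j)) ||
                 (column (markX G i) == column (markO G j)) in
  match u, v with
  | inl i, inr j | inr j, inl i => adj i j
  | _, _ => false
  end.

Definition represents_knot (G : grid) : Prop :=
  forall u v, connect (arc G) u v.

(* S(G), identified with the product of S_n and (Z/p)^n; it does not depend on
   the markings. *)
Definition gen : Type := ('S_n * {ffun 'I_n -> 'I_p})%type.

Definition pcoord (x : gen) (l : 'I_n) : nat := x.2 l.

(* The point of x on alpha_l. *)
Definition gpoint (x : gen) (l : 'I_n) : nat * nat :=
  ((pcoord x l * n + x.1 l)%N, val l).

Definition lift_point (P : 'I_n -> nat * nat) (ik : 'I_n * 'I_p) : nat * nat :=
  ((((P ik.1).1 + n * q * ik.2) %% (n * p))%N, ((P ik.1).2 + n * ik.2)%N).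

(* The finite subsets of the plane entering the gradings are given as families
   of points, which are injective in all the uses below. *)
Definition lift_gen (x : gen) (ik : 'I_n * 'I_p) : rat * rat :=
  let c := lift_point (gpoint x) ik in (c.1%:R, c.2%:R).

(* Markings sit at the centres of their squares; reduction of the abscissa
   modulo np commutes with the shift by 1/2. *)
Definition lift_mark (m : 'I_n -> square) (ik : 'I_n * 'I_p) : rat * rat :=
  let c := lift_point (fun i => corner (m i)) ik in
  (c.1%:R + 2^-1, c.2%:R + 2^-1).

Definition Icount (A B : 'I_n * 'I_p -> rat * rat) : nat :=
  #|[set st | ((A st.1).1 < (B st.2).1) && ((A st.1).2 < (B st.2).2)]|.

End Torus.

(* d(p, q, i) by recursion on the Euclidean algorithm; the second argument
   strictly decreases, so that the fuel k = q is sufficient. *)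
Fixpoint dlens_rec (k p q i : nat) : rat :=
  if k is k'.+1 then
    if q == 0%N then 0 else
    ((p * q)%:R - ((2 * i + 1)%:R - p%:R - q%:R) ^+ 2) / (4 * p * q)%:R
    + dlens_rec k' q (p %% q) (i %% q)
  else 0.

Definition dlens (p q i : nat) : rat := dlens_rec q p q i.

Lemma dlens100 : dlens 1 0 0 = 0.
Proof. by []. Qed.

Lemma dlensE p q i : (0 < q)%N ->
  dlens p q i =
  ((p * q)%:R - ((2 * i + 1)%:R - p%:R - q%:R) ^+ 2) / (4 * p * q)%:R
  + dlens q (p %% q) (i %% q).
Proof.
have fuel k l p' q' i' : (q' <= k)%N -> (q' <= l)%N ->
    dlens_rec k p' q' i' = dlens_rec l p' q' i'.
  elim: k l p' q' i' => [|k IHk] [|l] p' q' i' //=.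
  - by rewrite leqn0 => /eqP->.
  - by move=> _; rewrite leqn0 => /eqP->.
  case: eqVneq => // q0 lek lel; congr (_ + _).
  have lt_mod : (p' %% q' < q')%N by rewrite ltn_mod lt0n.
  by apply: IHk; rewrite -ltnS; apply: leq_trans lt_mod _.
move=> q_gt0; rewrite /dlens; case: q q_gt0 => // q _ /=; congr (_ + _).
by apply: fuel => //; rewrite -ltnS ltn_mod.
Qed.

Section Complex.
Variables (n p q : nat) (G : grid n p).

Let tX := lift_mark q (markX G).
Let tO := lift_mark q (markO G).

(* q.-1 is q - 1 modulo p also when (p, q) = (1, 0). *)
Definition Maslov (x : gen n p) : rat :=
  let tx := lift_gen q x in
  p%:R^-1 * ((Icount tx tx)%:R - (Icount tx tO)%:R
             - (Icount tO tx)%:R + (Icount tO tO)%:R)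
  + dlens p q q.-1 + 1.

Definition Alexander (x : gen n p) : rat :=
  let tx := lift_gen q x in
  (2 * p)%:R^-1 * ((Icount tO tO)%:R - (Icount tX tX)%:R
                   + 2 * (Icount tX tx)%:R - 2 * (Icount tO tx)%:R)
  + (1 - n%:R) / 2.

(* The values of S in Z/p are represented by their residues in {0, .., p-1}.
   The p-coordinate of the lower left corner (c, l) of a square is c %/ n. *)
Definition Spin (x : gen n p) : int :=
  ((q%:Z - 1 + ((\sum_(l < n) (pcoord x l)%:Z)
                - \sum_(i < n) ((corner (markO G i)).1 %/ n)%N%:Z)) %% p%:Z)%Z.

(* The rectangle [a, a+w] x [b, b+h]; its class modulo the lattice has a unique
   representative with lower left corner (a, b) in [0, pn) x [0, n). *)
Record rect : Type := MkRect {
  ra : 'I_(p * n); rb : 'I_n; rw : 'I_(p * n); rh : 'I_(p * n) }.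

Definition rect_tuple (r : rect) := (ra r, rb r, rw r, rh r).
Definition tuple_rect t := let: (a, b, w, h) := t in MkRect a b w h.
Lemma rect_tupleK : cancel rect_tuple tuple_rect.
Proof. by case. Qed.
HB.instance Definition _ := Finite.copy rect (can_type rect_tupleK).

(* The horizontal sides of r lie on two circles alpha_l1 and alpha_l2, so these
   carry the corners of r both in x and in y. *)
Definition Rect (x y : gen n p) (r : rect) : bool :=
  let a := val (ra r) in let b := val (rb r) in
  let w := val (rw r) in let h := val (rh r) in
  [&& (0 < w)%N, (0 < h)%N &
   [exists l1 : 'I_n, [exists l2 : 'I_n,
     [&& l1 != l2,
         same_point n p q (a, b) (gpoint x l1),
         same_point n p q ((a + w)%N, (b + h)%N) (gpoint x l2),
         same_point n p q ((a + w)%N, b) (gpoint y l1),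
         same_point n p q (a, (b + h)%N) (gpoint y l2) &
         [forall l : 'I_n,
            (l != l1) && (l != l2) ==> (gpoint x l == gpoint y l)]]]]].

(* Some interior point of r projects to a point of x. *)
Definition meets_interior (x : gen n p) (r : rect) : bool :=
  [exists s : 'I_(rw r), [exists t : 'I_(rh r), [exists l : 'I_n,
    [&& (0 < s)%N, (0 < t)%N &
        same_point n p q ((ra r + s)%N, (rb r + t)%N) (gpoint x l)]]]].

(* Emptiness is required with respect to both x and y.  For rectangles embedded
   in T the two requirements are equivalent.  An immersed rectangle may avoid x
   while covering one of its own corners that belongs to y, and such rectangles
   must be excluded: they lower the Maslov grading by more than 1, and counting
   them breaks the vanishing of the square of the differential. *)
Definition empty_rect (x y : gen n p) (r : rect) : bool :=
  [&& Rect x y r, ~~ meets_interior x r & ~~ meets_interior y r].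

(* The number of points of r projecting to the centre of the square s. *)
Definition mult (r : rect) (s : square n p) : nat :=
  #|[set ij : 'I_(rw r) * 'I_(rh r) |
      same_point n p q ((ra r + ij.1)%N, (rb r + ij.2)%N) (corner s)]|.

Definition avoidsX (r : rect) : bool := [forall i, mult r (markX G i) == 0%N].

Variables (K : comNzRingType) (V : 'I_n -> K).

Definition GC : Type := {ffun gen n p -> K^o}.

Definition gen_elt (x : gen n p) : GC := [ffun y => (x == y)%:R].

Definition bdry_gen (x : gen n p) : GC :=
  \sum_(y : gen n p) \sum_(r : rect | empty_rect x y r && avoidsX r)
    (\prod_(i < n) V i ^+ mult r (markO G i)) *: gen_elt y.

Definition bdry (c : GC) : GC := \sum_(x : gen n p) c x *: bdry_gen x.

Lemma bdry_linear : linear bdry.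
Proof.
move=> k c d; rewrite /bdry scaler_sumr -big_split /=; apply: eq_bigr => x _.
by rewrite !ffunE scalerDl scalerA.
Qed.
HB.instance Definition _ := GRing.isLinear.Build K GC GC _ bdry bdry_linear.

Lemma bdryE (x : gen n p) : bdry (gen_elt x) = bdry_gen x.
Proof.
rewrite /bdry (bigD1 x) //= !ffunE eqxx scale1r big1 ?addr0 // => y.
by rewrite eq_sym ffunE => /negPf->; rewrite scale0r.
Qed.

(* (M, A, S) of V^m y. *)
Definition tridegree (my : 'X_{1..n} * gen n p) : rat * rat * int :=
  (Maslov my.2 - 2 * (mdeg my.1)%:R, Alexander my.2 - (mdeg my.1)%:R,
   Spin my.2).

(* The component of tridegree d is the F-span of the V^m y of tridegree d; since
   F = Z/2, its elements are the finite sums of such V^m y.  In particular 0 is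
   homogeneous of every tridegree. *)
Definition homogeneous (d : rat * rat * int) (c : GC) : Prop :=
  exists2 t : seq ('X_{1..n} * gen n p),
    forall my, my \in t -> tridegree my = d &
    c = \sum_(my <- t) (\prod_(i < n) V i ^+ my.1 i) *: gen_elt my.2.

End Complex.

Definition Rminus (n : nat) := {mpoly 'F_2[n]}.

Definition Vminus (n : nat) (i : 'I_n) : Rminus n := 'X_i.

(* The ideal generated by V_i, in a decidable form. *)
Definition Videal (n : nat) (i : 'I_n) : {pred {mpoly 'F_2[n]}} :=
  fun f => all (fun m : 'X_{1..n} => (0 < m i)%N) (msupp f).

Lemma Videal_E (n : nat) (i : 'I_n) (f : {mpoly 'F_2[n]}) :
  reflect (exists g, f = 'X_i * g) (f \in Videal i).
Proof.
apply: (iffP allP) => [fV|[g ->] m].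
  exists (\sum_(m <- msupp f) f@_m *: 'X_[(m - U_(i))%MM]).
  rewrite [LHS]mpolyE mulr_sumr; apply: eq_big_seq => m /fV m_gt0.
  rewrite -scalerAr -mpolyXD; congr (_ *: 'X_[_]).
  by apply/mnmP => j; rewrite mnmDE mnmBE mnm1E; case: eqP => [<-|_] /=;
    rewrite ?add0n ?subn0 // add1n subn1 prednK.
by rewrite mulrC (perm_mem (msuppMX g U_(i))) => /mapP[k _ ->];
  rewrite mnmDE mnm1E eqxx.
Qed.

Lemma Videal_closed (n : nat) (i : 'I_n) : idealr_closed (Videal i).
Proof.
split=> [||a f g /Videal_E[f' ->] /Videal_E[g' ->]].
- by apply/Videal_E; exists 0; rewrite mulr0.
- by rewrite unfold_in msupp1 /= mnm0E.
by apply/Videal_E; exists (a * f' + g'); rewrite mulrDr mulrCA.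
Qed.
HB.instance Definition _ (n : nat) (i : 'I_n) :=
  isIdealr.Build {mpoly 'F_2[n]} (Videal i) (Videal_closed i).

Definition Rhat (n : nat) (i0 : 'I_n) := {ideal_quot (Videal i0)}.

Definition Vhat (n : nat) (i0 i : 'I_n) : Rhat i0 := \pi_(Rhat i0) (Vminus i).

(* Main.v *)
(* A generator x is identified with its preimage in the plane, a set invariant under
   the lattice.  A rectangle from x to y is a pair P < Q of inequivalent points of
   this set, up to translation, and y is obtained by replacing their orbits by those
   of the two other corners.  Comparing the lifts of x and y gives, for every
   rectangle r, empty or not,
     M(x) - M(y) = 1 + #(x in int r) + #(y in int r) - 2 #(O in r),
     A(x) - A(y) = #(X in r) - #(O in r),
   whence the effect of the differential on the gradings.

   For the vanishing of the square, the pairs of consecutive rectangles from x to z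
   are matched by a fixed point free involution preserving z and the multiplicities
   of the union: rectangles with disjoint corners are swapped, L-shapes are cut in
   the other way, and a union which is an annulus transverse to the grid, cut along
   two vertical segments, is cut along two spiralling horizontal ones.  The new pair
   has the same O multiplicities, so by the formula for M it is empty since the old
   one is.  Closed rows and columns of squares do not occur, as they contain an X. *)

Require Import Defs.
From mathcomp Require Import all_boot all_order all_algebra all_fingroup.
From mathcomp Require Import ring_quotient mpoly.
From mathcomp Require Import zify ring lra.
Import Order.TTheory GRing.Theory Num.Theory.
Local Open Scope ring_scope.

Set Implicit Arguments.
Unset Strict Implicit.
Unset Printing Implicit Defensive.

(** The gradings use the representatives of points in $[0,pn)^2$, so their counts are not obviously
    functions on the torus. Exchanging two columns changes a product kernel by its mixed difference
    over the four corners of the rectangle, which factors into one variation per coordinate;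
    reduction modulo [pn] perturbs each variation by a number of wraps. This perturbation depends on
    the rectangle only, and in each grading the variations occur with opposite signs in equal
    number.

    Immersed rectangles may overlap themselves, so the emptiness of a new pair cannot be read off
    the shape of the union; hence the formula for M is established for rectangles with crossings
    too. The matching is an explicit formula on corners in the plane: its compatibility with
    translations makes it a map on rectangles of the torus, and involutivity becomes a computation.
    For a transverse annulus, the number of turns of the new cut is an integer quotient, and
    oriented box sums allow areas to be compared by induction on it, through decompositions that are
    not geometric. *)

(** * Cancellation in pairs in characteristic 2 *)

(** Comparing [enum_rank] selects one element of each pair [t], [phi t], and [phi] carries the
    selected half onto the other, so the total is twice a half sum. *)
Lemma sum_involution_char2 (V : zmodType) (T : finType) (P : pred T)
    (F : T -> V) (phi : T -> T) :
  (forall v : V, v + v = 0) ->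
  (forall t, P t -> P (phi t)) -> (forall t, P t -> phi (phi t) = t) ->
  (forall t, P t -> phi t != t) -> (forall t, P t -> F (phi t) = F t) ->
  \sum_(t | P t) F t = 0.
Proof.
move=> V2 Pphi phiK phi_neq Fphi.
pose lt t := (enum_rank t < enum_rank (phi t))%N.
rewrite (bigID lt) /=.
have -> : \sum_(t | P t && ~~ lt t) F t = \sum_(t | P t && lt t) F t.
  rewrite (reindex_onto phi phi) /=; last by move=> t /andP[/phiK].
  apply: eq_big => [t|t /andP[/andP[Pt _] /eqP tE]]; last first.
    by rewrite -[in RHS]tE [RHS]Fphi.
  apply/idP/idP => [/andP[/andP[Pt lt_t] /eqP tE]|/andP[Pt lt_t]].
    have Pt' : P t by rewrite -tE Pphi.
    rewrite Pt' /=; move: lt_t; rewrite /lt tE -leqNgt leq_eqVlt.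
    case/orP=> // /eqP/val_inj/enum_rank_inj tE'.
    by move: (phi_neq _ Pt'); rewrite -tE' eqxx.
  rewrite Pphi // phiK // eqxx andbT /= /lt phiK // -leqNgt.
  exact: ltnW.
exact: V2.
Qed.

(** * Oriented sums over boxes *)

Lemma int_step_const (V : Type) (f : int -> V) :
  (forall a, f (a + 1) = f a) -> forall a, f a = f 0.
Proof.
move=> fS; case=> k; first by elim: k => // k <-; rewrite -[RHS]fS; congr f; lia.
elim: k => [|k <-]; last by rewrite -[in LHS]fS; congr f; lia.
by rewrite -[in LHS]fS; congr f.
Qed.

(** The discrete antiderivative of [F] that vanishes at 0; [Negz k] is $-(k+1)$, whence the shifted
    indices. *)
Definition prim (F : int -> int) (a : int) : int :=
  match a with
  | Posz k => \sum_(i < k) F i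
  | Negz k => - \sum_(i < k.+1) F (- (i.+1)%:Z)
  end.

Lemma primS F a : prim F (a + 1) = prim F a + F a.
Proof.
case: a => k.
  have -> : Posz k + 1 = Posz k.+1 by lia.
  by rewrite /prim big_ord_recr.
case: k => [|k].
  have -> : Negz 0 + 1 = 0 by [].
  by rewrite /= big_ord0 big_ord1 addNr.
have -> : Negz k.+1 + 1 = Negz k by lia.
rewrite /prim [in RHS]big_ord_recr /= opprD -addrA.
have -> : Negz k.+1 = - Posz k.+2 by lia.
by rewrite addNr addr0.
Qed.

(* The oriented sum of F over [a, b); it changes sign when the bounds are
   exchanged. *)
Definition isum F a b := prim F b - prim F a.

Lemma isumS F a b : isum F a (b + 1) = isum F a b + F b.
Proof. by rewrite /isum primS addrAC. Qed.

(** Two antiderivatives differ by a constant, so any of them computes the sum, whatever the order of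
    the bounds. *)
Lemma isum_eq (F : int -> int) (f : int -> int) a b :
  (forall c, f (c + 1) = f c + F c) -> isum F a b = f b - f a.
Proof.
move=> fS; rewrite /isum.
have h c : prim F c - f c = prim F 0 - f 0.
  by apply: (@int_step_const _ (fun c => prim F c - f c)) => d; rewrite primS fS; ring.
have ha := h a; have hb := h b; lia.
Qed.

Lemma isum_ext F F' a b : (forall i, F i = F' i) -> isum F a b = isum F' a b.
Proof. by move=> FF'; apply: isum_eq => c; rewrite primS FF'. Qed.

Lemma isumB F F' a b :
  isum (fun i => F i - F' i) a b = isum F a b - isum F' a b.
Proof.
rewrite (@isum_eq _ (fun c => prim F c - prim F' c)); last by move=> c; rewrite !primS; ring.
by rewrite /isum; ring.
Qed.

Lemma isum_shift F u a b :
  isum (fun i => F (i + u)) a b = isum F (a + u) (b + u).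
Proof.
apply: (@isum_eq _ (fun c => prim F (c + u))) => c.
by rewrite -primS; congr prim; ring.
Qed.

Lemma isum_nat F a k : isum F a (a + k%:Z) = \sum_(i < k) F (a + i%:Z).
Proof.
elim: k => [|k IHk]; first by rewrite addr0 big_ord0 /isum subrr.
by rewrite big_ord_recr /= -IHk -isumS; congr isum; lia.
Qed.

Lemma isum_sum (I : finType) (F : I -> int -> int) a b :
  isum (fun i => \sum_(k : I) F k i) a b = \sum_(k : I) isum (F k) a b.
Proof.
rewrite (@isum_eq _ (fun c => \sum_(k : I) prim (F k) c)).
  by rewrite -sumrB.
by move=> c; rewrite -big_split; apply: eq_bigr => k _; rewrite primS.
Qed.

Lemma isumM F k a b : isum (fun i => F i * k) a b = isum F a b * k.
Proof.
rewrite (@isum_eq _ (fun c => prim F c * k)); last by move=> c; rewrite primS; ring.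
by rewrite /isum; ring.
Qed.

Definition boxsum (f : int -> int -> int) x1 x2 y1 y2 :=
  isum (fun i => isum (f i) y1 y2) x1 x2.

(** A double antiderivative. It reduces identities between areas to linear arithmetic on corner
    values, for boxes of any orientation. *)
Lemma boxsum_potential f : exists G : int -> int -> int, forall x1 x2 y1 y2,
  boxsum f x1 x2 y1 y2 = G x2 y2 - G x1 y2 - G x2 y1 + G x1 y1.
Proof.
exists (fun c d => prim (fun i => prim (f i) d) c) => x1 x2 y1 y2.
by rewrite /boxsum isumB /isum; ring.
Qed.

Lemma boxsum_shift f u v x1 x2 y1 y2 :
  (forall i j, f (i + u) (j + v) = f i j) ->
  boxsum f (x1 + u) (x2 + u) (y1 + v) (y2 + v) = boxsum f x1 x2 y1 y2.
Proof.
move=> fuv; rewrite /boxsum -isum_shift; apply: isum_ext => i.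
by rewrite -isum_shift; apply: isum_ext => j.
Qed.

Lemma boxsum_nat f a b w h :
  boxsum f a (a + w%:Z) b (b + h%:Z) =
  \sum_(i < w) \sum_(j < h) f (a + i%:Z) (b + j%:Z).
Proof. by rewrite /boxsum isum_nat; apply: eq_bigr => i _; rewrite isum_nat. Qed.

Lemma boxsum_ext f g x1 x2 y1 y2 : (forall i j, f i j = g i j) ->
  boxsum f x1 x2 y1 y2 = boxsum g x1 x2 y1 y2.
Proof. by move=> fg; apply: isum_ext => i; apply: isum_ext => j. Qed.

Lemma boxsum_sum (I : finType) (F : I -> int -> int -> int) x1 x2 y1 y2 :
  boxsum (fun i j => \sum_k F k i j) x1 x2 y1 y2 =
  \sum_k boxsum (F k) x1 x2 y1 y2.
Proof.
rewrite /boxsum -isum_sum; apply: isum_ext => i; exact: isum_sum.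
Qed.

Lemma boxsum_prod (f g : int -> int) x1 x2 y1 y2 :
  boxsum (fun i j => f i * g j) x1 x2 y1 y2 = isum f x1 x2 * isum g y1 y2.
Proof.
rewrite /boxsum -isumM; apply: isum_ext => i.
rewrite mulrC -isumM; apply: isum_ext => j; ring.
Qed.

(** * The lattice and its invariant sets *)

Section Lattice.
Variables n p q : nat.
Hypotheses (hn : (0 < n)%N) (hp : (0 < p)%N) (cop : coprime p q).
Local Notation L := (in_lattice n p q).
Local Notation N := (p * n)%N.

Lemma lattice0 : L 0 0.
Proof. by apply/in_latticeP; exists 0, 0; rewrite !mul0r. Qed.

Lemma latticeB u v u' v' : L u v -> L u' v' -> L (u - u') (v - v').
Proof.
move=> /in_latticeP[s [t [-> ->]]] /in_latticeP[s' [t' [-> ->]]].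
by apply/in_latticeP; exists (s - s'), (t - t'); split; ring.
Qed.

Lemma latticeN u v : L u v -> L (- u) (- v).
Proof. by move/(latticeB lattice0); rewrite !sub0r. Qed.

Lemma latticeD u v u' v' : L u v -> L u' v' -> L (u + u') (v + v').
Proof. by move=> h /latticeN/(latticeB h); rewrite !opprK. Qed.

Lemma latticeDr u v u' v' : L u' v' -> L (u + u') (v + v') = L u v.
Proof.
move=> h; apply/idP/idP => [/latticeB/(_ h)|/latticeD/(_ h)//].
by rewrite !addrK.
Qed.

Lemma lattice_dvd1 u v : L u v -> (n%:Z %| u)%Z.
Proof.
move=> /in_latticeP[s [t [-> _]]]; apply/dvdzP; exists (s * p%:Z + t * q%:Z).
by rewrite !PoszM; ring.
Qed.

Lemma lattice_dvd2 u v : L u v -> (n%:Z %| v)%Z.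
Proof. by case/andP. Qed.

Lemma lattice_row u : L u 0 = (N%:Z %| u)%Z.
Proof. by rewrite /in_lattice dvdz0 div0z mul0r subr0. Qed.

(** Beta circles, like alpha circles, have length [pn]. Coprimality enters here: from $sp+tq=0$, [p]
    divides $tq$, hence [t]. *)
Lemma lattice_col v : L 0 v = (N%:Z %| v)%Z.
Proof.
apply/idP/idP => [/in_latticeP[s [t [sE ->]]]|/dvdzP[s ->]]; last first.
  by apply/in_latticeP; exists (- s * q%:Z), (s * p%:Z); split; rewrite !PoszM; ring.
rewrite PoszM; apply: dvdz_mul => //.
have : s * p%:Z + t * q%:Z = 0.
  have n0 : n%:Z != 0 by lia.
  by apply: (mulIf n0); move: sE; rewrite !PoszM mul0r => ->; ring.
move/eqP; rewrite addrC addr_eq0 => /eqP tq.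
have : (p%:Z %| t * q%:Z)%Z by rewrite tq -mulNr dvdz_mull.
by rewrite Gauss_dvdzl.
Qed.

Lemma lattice_ex1 v : (n%:Z %| v)%Z -> exists u, L u v.
Proof.
case/dvdzP=> t ->; exists (t * (q * n)%:Z); apply/in_latticeP.
by exists 0, t; rewrite mul0r add0r.
Qed.

Lemma lattice_ex2 u : (n%:Z %| u)%Z -> exists v, L u v.
Proof.
case/dvdzP=> d ->; have /coprimezP[[a b] /= ab] : coprimez p q by [].
exists (d * b * n%:Z); apply/in_latticeP; exists (d * a), (d * b); split=> //.
rewrite -[in LHS](mulr1 d) -ab !PoszM; ring.
Qed.

(** * Points of the plane modulo the lattice *)

Definition eqpt (T U : int * int) := L (T.1 - U.1) (T.2 - U.2).

Lemma eqpt_refl T : eqpt T T.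
Proof. by rewrite /eqpt !subrr lattice0. Qed.

Lemma eqpt_sym T U : eqpt T U = eqpt U T.
Proof. by apply/idP/idP => /latticeN; rewrite !opprB. Qed.

Lemma eqpt_trans U T T' : eqpt T U -> eqpt U T' -> eqpt T T'.
Proof. by move=> h /(latticeD h); rewrite !addrA !subrK. Qed.

Lemma eqptl T U V : eqpt T U -> eqpt T V = eqpt U V.
Proof.
move=> h; apply/idP/idP; last exact: eqpt_trans.
by apply: eqpt_trans; rewrite eqpt_sym.
Qed.

Lemma eqpt_shift u v (T U : int * int) : L u v ->
  eqpt (T.1 + u, T.2 + v) U = eqpt T U.
Proof.
by move=> h; rewrite /eqpt /= (addrAC T.1) (addrAC T.2) (latticeDr _ _ h).
Qed.

(** Lattice vectors have both coordinates divisible by [n], so this tells whether two ordinates are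
    on the same alpha circle, or two abscissas on the same beta circle. *)
Definition cg (a b : int) := (n%:Z %| a - b)%Z.

Lemma cg_refl a : cg a a.
Proof. by rewrite /cg subrr. Qed.

Lemma cg_sym a b : cg a b = cg b a.
Proof. by rewrite /cg -[in RHS]opprB rpredN. Qed.

Lemma cg_trans b a c : cg a b -> cg b c -> cg a c.
Proof. by move=> h h'; rewrite /cg -(subrK b a) -addrA; apply: rpredD. Qed.

Lemma cgl a b c : cg a b -> cg a c = cg b c.
Proof.
move=> h; apply/idP/idP; last exact: cg_trans.
by apply: cg_trans; rewrite cg_sym.
Qed.

Lemma cgr a b c : cg a b -> cg c a = cg c b.
Proof. by move=> h; rewrite ![cg c _]cg_sym (cgl _ h). Qed.

Lemma eqpt_cg1 T U : eqpt T U -> cg T.1 U.1.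
Proof. exact: lattice_dvd1. Qed.

Lemma eqpt_cg2 T U : eqpt T U -> cg T.2 U.2.
Proof. exact: lattice_dvd2. Qed.

(* The preimages in the plane of the generators are the lattice-invariant sets
   with one orbit in each row and in each column. *)
Record is_state (s : int * int -> bool) : Prop := IsState {
  st_inv : forall T U, eqpt T U -> s T = s U;
  st_row : forall T U, s T -> s U -> cg T.2 U.2 -> eqpt T U;
  st_col : forall T U, s T -> s U -> cg T.1 U.1 -> eqpt T U;
  st_exrow : forall b, exists c, s (c, b)
}.

(** A state has one orbit in each row, so the exchange of the columns of [P] and [Q] can be
    prescribed row by row. *)
Definition swp (s : int * int -> bool) (P Q T : int * int) : bool :=
  if cg T.2 P.2 then eqpt T (Q.1, P.2)
  else if cg T.2 Q.2 then eqpt T (P.1, Q.2) else s T.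

(** The two rows keep one orbit each and exchange their columns. These columns are distinct, since
    points of a state in one column are equivalent and hence in one row. *)
Lemma swp_state s P Q :
  is_state s -> s P -> s Q -> ~~ cg P.2 Q.2 -> is_state (swp s P Q).
Proof.
move=> hs sP sQ nPQ.
have nPQ1 : ~~ cg P.1 Q.1.
  by apply: contra nPQ => /(st_col hs sP sQ)/eqpt_cg2.
have colC T U : s T -> cg T.1 U.1 -> s U -> cg T.2 U.2.
  by move=> sT h sU; apply: eqpt_cg2; apply: (st_col hs).
split.
- move=> T U h; have h2 := eqpt_cg2 h.
  by rewrite /swp !(cgl _ h2) !(eqptl _ h) (st_inv hs h).
- move=> T U; rewrite /swp => sT sU h; move: sT sU.
  rewrite !(cgl _ h); case: ifP => _.
    by move=> h1 h2; rewrite (eqptl _ h1) eqpt_sym.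
  case: ifP => _.
    by move=> h1 h2; rewrite (eqptl _ h1) eqpt_sym.
  by move=> h1 h2; apply: (st_row hs).
- move=> T U; rewrite /swp.
  case: ifP => [_ h1|TP].
    case: ifP => [_ h2 _|UP]; first by rewrite (eqptl _ h1) eqpt_sym.
    case: ifP => [_ h2|UQ sU]; rewrite (cgl _ (eqpt_cg1 h1)) /=.
      by rewrite (cgr _ (eqpt_cg1 h2)) /= cg_sym (negbTE nPQ1).
    by rewrite cg_sym => /(colC _ _ sU)/(_ sQ); rewrite UQ.
  case: ifP => [_ h1|TQ sT].
    case: ifP => [_ h2|UP].
      by rewrite (cgl _ (eqpt_cg1 h1)) (cgr _ (eqpt_cg1 h2)) /= (negbTE nPQ1).
    case: ifP => [_ h2 _|UQ sU]; first by rewrite (eqptl _ h1) eqpt_sym.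
    by rewrite (cgl _ (eqpt_cg1 h1)) /= cg_sym => /(colC _ _ sU)/(_ sP); rewrite UP.
  case: ifP => [_ h2|UP].
    by rewrite (cgr _ (eqpt_cg1 h2)) /= => /(colC _ _ sT)/(_ sQ); rewrite TQ.
  case: ifP => [_ h2|UQ sU]; last exact: (st_col hs).
  by rewrite (cgr _ (eqpt_cg1 h2)) /= => /(colC _ _ sT)/(_ sP); rewrite TP.
- move=> b; rewrite /swp /=.
  case: (boolP (cg b P.2)) => [/lattice_ex1[u h]|_]; first by exists (Q.1 + u); rewrite /eqpt /= addrAC subrr add0r.
  case: (boolP (cg b Q.2)) => [/lattice_ex1[u h]|_]; first by exists (P.1 + u); rewrite /eqpt /= addrAC subrr add0r.
  exact: (st_exrow hs).
Qed.

(** * Generators as invariant sets *)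

Definition gpt (x : gen n p) (l : 'I_n) : int * int :=
  ((gpoint x l).1%:Z, (gpoint x l).2%:Z).

Definition on (x : gen n p) (T : int * int) : bool := [exists l, eqpt T (gpt x l)].

Lemma on_gpt x l : on x (gpt x l).
Proof. by apply/existsP; exists l; apply: eqpt_refl. Qed.

Lemma cg_ord (i j : 'I_n) : cg i%:Z j%:Z -> i = j.
Proof.
rewrite /cg => /dvdzP[t tE]; apply/val_inj => /=; have := ltn_ord i; have := ltn_ord j.
move: tE; move: (nat_of_ord i) (nat_of_ord j) => a b; case: t => [[|t]|t]; nia.
Qed.

Lemma cgMD (a : nat) (i : nat) (j : int) : cg (a * n + i)%N%:Z j = cg i%:Z j.
Proof.
apply: cgl; rewrite /cg PoszD addrK PoszM; exact: dvdz_mull.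
Qed.

Lemma on_row x (l : 'I_n) T : on x T -> cg T.2 l%:Z -> eqpt T (gpt x l).
Proof.
case/existsP=> l' h; rewrite (cgl _ (eqpt_cg2 h)) => /cg_ord.
by move=> <-.
Qed.

Definition residue (M : nat) (hM : (0 < M)%N) (a : int) : 'I_M :=
  Ordinal (ltn_pmod `|(a %% M%:Z)%Z| hM).

Lemma residue_bounds (a : int) (M : nat) : (0 < M)%N -> 0 <= (a %% M%:Z)%Z < M%:Z.
Proof. by move=> M0; rewrite modz_ge0 ?ltz_pmod //; lia. Qed.

Lemma residueE M (hM : (0 < M)%N) a : (residue hM a)%:Z = (a %% M%:Z)%Z.
Proof.
have h : (0 <= (a %% M%:Z)%Z < M%:Z) by rewrite modz_ge0 ?ltz_pmod //; lia.
by rewrite /=; move: h; move: (a %% M%:Z)%Z => r h; rewrite modn_small; lia.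
Qed.

Lemma residue_dvd M (hM : (0 < M)%N) a : (M%:Z %| a - (residue hM a)%:Z)%Z.
Proof. by rewrite residueE {1}(divz_eq a M%:Z) addrK dvdz_mull. Qed.

Lemma residue_small M (hM : (0 < M)%N) a : 0 <= a < M%:Z -> (residue hM a)%:Z = a.
Proof. by move=> h; rewrite residueE modz_small. Qed.

Lemma cg_ex b : exists l : 'I_n, cg b l%:Z.
Proof.
by exists (residue hn b); apply: residue_dvd.
Qed.

Lemma on_state x : is_state (on x).
Proof.
split.
- by move=> T U h; apply: eq_existsb => l; apply: eqptl.
- move=> T U sT sU; case/existsP: (sU) => l hU.
  rewrite (cgr _ (eqpt_cg2 hU)) => /(on_row sT) h.
  by rewrite (eqptl _ h) eqpt_sym.
- move=> T U /existsP[l hT] /existsP[l' hU].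
  rewrite (cgl _ (eqpt_cg1 hT)) (cgr _ (eqpt_cg1 hU)) /= cgMD cg_sym cgMD.
  move=> /cg_ord/perm_inj ll'; move: hU; rewrite ll' (eqptl _ hT) eqpt_sym.
  done.
move=> b; have [l h] := cg_ex b.
have [u hu] := lattice_ex1 h.
exists ((gpt x l).1 + u); apply/existsP; exists l.
by rewrite /eqpt /= addrAC subrr add0r.
Qed.

Lemma pcoord_inj (a b : 'I_p) (i j : 'I_n) :
  (a * n + i = b * n + j)%N -> a = b /\ i = j.
Proof.
move=> h; have ij : i = j.
  by apply: cg_ord; rewrite -(cgMD a) h cgMD cg_refl.
by split=> //; apply/val_inj => /=; move: h; rewrite ij; nia.
Qed.

Lemma gpoint1_lt (x : gen n p) (l : 'I_n) : ((gpoint x l).1 < N)%N.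
Proof.
rewrite /gpoint /= /pcoord; have := ltn_ord (x.2 l); have := ltn_ord (x.1 l).
move: (nat_of_ord (x.2 l)) (nat_of_ord (x.1 l)) => a b; nia.
Qed.

Lemma dvd_small (M a b : nat) : (a < M)%N -> (b < M)%N ->
  (M%:Z %| a%:Z - b%:Z)%Z -> a = b.
Proof. by move=> ha hb /dvdzP[[[|t]|t] tE]; nia. Qed.

Lemma on_inj x y : (forall T, on x T = on y T) -> x = y.
Proof.
move=> xy.
have h l : gpoint x l = gpoint y l.
  have: eqpt (gpt x l) (gpt y l) by apply: on_row; rewrite -?xy ?on_gpt ?cg_refl.
  rewrite /eqpt /= subrr lattice_row => /(dvd_small _ _) h.
  rewrite /gpoint; congr pair; apply: h; exact: gpoint1_lt.
have {}h l : x.2 l = y.2 l /\ x.1 l = y.1 l.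
  by apply: pcoord_inj; case: (h l).
case: x y h {xy} => [s f] [s' f'] /= h; congr pair.
  by apply/permP => l; case: (h l).
by apply/ffunP => l; case: (h l).
Qed.

Lemma ltn_divN (c : 'I_N) : (c %/ n < p)%N.
Proof. by rewrite ltn_divLR. Qed.

Lemma N_gt0 : (0 < N)%N.
Proof. by rewrite muln_gt0 hp. Qed.

(** Each row has a point with abscissa in $[0,pn)$. The remainder modulo [n] is its column,
    injective in the row by [st_col] and so a permutation; the quotient is the [p]-coordinate. *)
Lemma realize s : is_state s -> exists y, forall T, on y T = s T.
Proof.
move=> hs.
have exc (l : 'I_n) : exists c : 'I_N, s (c%:Z, l%:Z).
  have [c sc] := st_exrow hs l%:Z; exists (residue N_gt0 c).
  rewrite -(st_inv hs (T := (c, l%:Z))) // /eqpt /= subrr lattice_row.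
  exact: (residue_dvd N_gt0 c).
pose c l := xchoose (exc l); have sc l : s ((c l)%:Z, l%:Z) := xchooseP (exc l).
pose f l : 'I_n := Ordinal (ltn_pmod (c l) hn).
have cE l : (c l : nat) = (c l %/ n * n + f l)%N by exact: divn_eq.
have f_inj : injective f.
  move=> l l' ff; have /= h := st_col hs (sc l) (sc l').
  apply: cg_ord; apply: (eqpt_cg2 (h _)).
  by rewrite (cE l) cgMD cg_sym (cE l') cgMD ff cg_refl.
exists (perm f_inj, [ffun l => Ordinal (ltn_divN (c l))]) => T.
have gE l : gpt (perm f_inj, [ffun l => Ordinal (ltn_divN (c l))]) l = ((c l)%:Z, l%:Z).
  by rewrite /gpt /gpoint /pcoord /= ffunE permE -cE.
apply/existsP/idP => [[l]|sT]; first by rewrite gE => /(st_inv hs) ->.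
have [l h] := cg_ex T.2; exists l; rewrite gE.
exact: (st_row hs).
Qed.

(** * Rectangles in the plane *)

Definition below (P Q : int * int) := (P.1 < Q.1) && (P.2 < Q.2).

Definition corner_ll (r : rect n p) : int * int := ((ra r)%:Z, (rb r)%:Z).
Definition corner_ur (r : rect n p) : int * int :=
  ((ra r)%:Z + (rw r)%:Z, (rb r)%:Z + (rh r)%:Z).

Lemma gpt2 x l : (gpt x l).2 = l%:Z. Proof. by []. Qed.

Lemma gpt_eq x y (l : 'I_n) : eqpt (gpt x l) (gpt y l) -> gpoint x l = gpoint y l.
Proof.
rewrite /eqpt /= subrr lattice_row => /(dvd_small _ _) h.
by rewrite /gpoint; congr pair; apply: h; exact: gpoint1_lt.
Qed.

(** A point of a generator is determined by its row up to the lattice, so agreement circle by circle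
    amounts to an equality of invariant sets. In particular [x] and [r] determine [y]. *)
Lemma RectP (x y : gen n p) (r : rect n p) :
  let P := corner_ll r in let Q := corner_ur r in
  reflect [/\ below P Q, on x P, on x Q, ~~ cg P.2 Q.2 &
             forall T, on y T = swp (on x) P Q T]
          (Rect q x y r).
Proof.
move=> P Q; have spE A B : same_point n p q A B = eqpt (A.1%:Z, A.2%:Z) (B.1%:Z, B.2%:Z).
  by [].
apply: (iffP and3P) => [[w0 h0 /existsP[l1 /existsP[l2 /and5P[ne xP xQ yS /andP[yW /forallP rest]]]]]|].
  move: xP xQ yS yW; rewrite !spE /= !PoszD.
  rewrite -/(gpt x l1) -/(gpt x l2) -/(gpt y l1) -/(gpt y l2) => xP xQ yS yW.
  have ne' : ~~ cg P.2 Q.2.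
    apply: contra ne => h; apply/eqP/cg_ord; rewrite -!(gpt2 x).
    by rewrite -(cgl _ (eqpt_cg2 xP)) -(cgr _ (eqpt_cg2 xQ)).
  split=> //; first by move: w0 h0; rewrite /below /P /Q /=; lia.
  - by rewrite (st_inv (on_state x) xP) on_gpt.
  - by rewrite (st_inv (on_state x) xQ) on_gpt.
  move=> T; rewrite /swp.
  case: ifP => [TP|TP].
    have Tl1 : cg T.2 l1%:Z by rewrite (cgl _ TP) -(gpt2 x); exact: (eqpt_cg2 xP).
    apply/idP/idP => [/on_row/(_ Tl1) h|h].
      by rewrite (eqptl _ h) eqpt_sym.
    by rewrite (st_inv (on_state y) h) (st_inv (on_state y) yS) on_gpt.
  case: ifP => [TQ|TQ].
    have Tl2 : cg T.2 l2%:Z by rewrite (cgl _ TQ) -(gpt2 x); exact: (eqpt_cg2 xQ).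
    apply/idP/idP => [/on_row/(_ Tl2) h|h].
      by rewrite (eqptl _ h) eqpt_sym.
    by rewrite (st_inv (on_state y) h) (st_inv (on_state y) yW) on_gpt.
  have [l Tl] := cg_ex T.2.
  have gl : gpoint x l = gpoint y l.
    have := rest l; case: eqP => [ll1|_] /=.
      by move: TP; rewrite (cgl _ Tl) ll1 cg_sym -(gpt2 x) (eqpt_cg2 xP).
    case: eqP => [ll2|_ /eqP//].
    by move: TQ; rewrite (cgl _ Tl) ll2 cg_sym -(gpt2 x) (eqpt_cg2 xQ).
  have gl' : gpt x l = gpt y l by rewrite /gpt gl.
  apply/idP/idP => /on_row/(_ Tl) h.
    by rewrite (st_inv (on_state x) h) -gl' on_gpt.
  by rewrite (st_inv (on_state y) h) gl' on_gpt.
case=> PQ /[dup] xP /existsP[l1 xP1] /[dup] xQ /existsP[l2 xQ2] ne yE.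
move: PQ; rewrite /below /P /Q /= => /andP[w0 h0]; split=> /=; [lia | lia |].
apply/existsP; exists l1; apply/existsP; exists l2.
have l1E := eqpt_cg2 xP1; have l2E := eqpt_cg2 xQ2.
rewrite !spE /= !PoszD -/(gpt x l1) -/(gpt x l2) -/(gpt y l1) -/(gpt y l2).
apply/and5P; split=> //; last (apply/andP; split).
- apply: contra ne => /eqP ll; rewrite (cgl _ l1E) (cgr _ l2E) ll; exact: cg_refl.
- apply: (@on_row y l1) => //; rewrite yE /swp /= cg_refl; exact: eqpt_refl.
- apply: (@on_row y l2) => //; rewrite yE /swp /= cg_sym.
  rewrite -/P.2 -/Q.2 (negbTE ne) cg_refl; exact: eqpt_refl.
apply/forallP => l; apply/implyP => /andP[ll1 ll2]; apply/eqP/gpt_eq.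
apply: (@on_row y l); last by rewrite gpt2 cg_refl.
rewrite yE /swp gpt2 (cgr _ l1E) (cgr _ l2E) !gpt2.
case: ifP => [/cg_ord/eqP|_]; first by rewrite (negbTE ll1).
case: ifP => [/cg_ord/eqP|_]; first by rewrite (negbTE ll2).
exact: on_gpt.
Qed.

(** The normal form of a rectangle up to translation: lowering [P] by [P.2 %/ n] periods moves its
    abscissa by as many multiples of [qn]. The side lengths are preserved under [small_rect]. *)
Definition mkrect (P Q : int * int) : rect n p :=
  MkRect (residue N_gt0 (P.1 - (P.2 %/ n%:Z)%Z * (q * n)%:Z)) (residue hn P.2)
         (residue N_gt0 (Q.1 - P.1)) (residue N_gt0 (Q.2 - P.2)).

Lemma corner_ll_mkrect P Q : eqpt (corner_ll (mkrect P Q)) P.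
Proof.
rewrite eqpt_sym /eqpt /corner_ll [ra _]/= [rb _]/= [(_, _).1]/= [(_, _).2]/=.
set t := (P.2 %/ n%:Z)%Z; apply/in_latticeP.
have /dvdzP[s sE] := residue_dvd N_gt0 (P.1 - t * (q * n)%:Z).
exists s, t; split; first by rewrite -sE; ring.
have h : P.2 - (residue hn P.2)%:Z = t * n%:Z.
  by apply/eqP; rewrite subr_eq residueE; apply/eqP; exact: divz_eq.
exact: h.
Qed.

Definition small_rect (P Q : int * int) :=
  (0 < Q.1 - P.1 < N%:Z) && (0 < Q.2 - P.2 < N%:Z).

Lemma corner_ur_mkrect P Q : small_rect P Q ->
  corner_ur (mkrect P Q) = ((corner_ll (mkrect P Q)).1 + (Q.1 - P.1),
                            (corner_ll (mkrect P Q)).2 + (Q.2 - P.2)).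
Proof.
case/andP=> h1 h2; rewrite /corner_ur [rw _]/= [rh _]/=.
rewrite (@residue_small _ _ (Q.1 - P.1)) ?(@residue_small _ _ (Q.2 - P.2)) //; lia.
Qed.

Definition same_rect (P Q P' Q' : int * int) :=
  [/\ eqpt P P', Q.1 - P.1 = Q'.1 - P'.1 & Q.2 - P.2 = Q'.2 - P'.2].

Lemma mkrectE P Q : small_rect P Q ->
  same_rect (corner_ll (mkrect P Q)) (corner_ur (mkrect P Q)) P Q.
Proof.
move=> h; rewrite /same_rect corner_ur_mkrect //=; split; [|ring|ring].
exact: corner_ll_mkrect.
Qed.

Lemma rect_eq (r r' : rect n p) :
  same_rect (corner_ll r) (corner_ur r) (corner_ll r') (corner_ur r') -> r = r'.
Proof.
case: r r' => [a b w h] [a' b' w' h'] []; rewrite /corner_ll /corner_ur /=.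
move=> e ew eh.
have bb : b = b' by apply: cg_ord; exact: (eqpt_cg2 e).
move: e; rewrite /eqpt /= bb subrr lattice_row => /dvd_small ha.
congr MkRect => //; apply: val_inj => /=; [exact: ha | lia | lia].
Qed.

(** The indicator of an orbit. Unit squares are represented by their lower left corners, so
    half-open box sums of it count squares. *)
Definition at_pt (c : int * int) (i j : int) : int := (eqpt (i, j) c)%:R.

Definition area (f : int -> int -> int) (P Q : int * int) :=
  boxsum f P.1 Q.1 P.2 Q.2.

Lemma multE r (s : square n p) :
  (mult q r s)%:Z =
  area (at_pt ((corner s).1%:Z, (corner s).2%:Z)) (corner_ll r) (corner_ur r).
Proof.
rewrite /area boxsum_nat pair_big /= /mult -sum1_card big_mkcond /=.
rewrite -natz natr_sum; apply: eq_bigr => ij _.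
by rewrite inE /at_pt /same_point !PoszD; case: ifP => h; rewrite /eqpt /= h.
Qed.

Lemma boxsumP (f : int -> int -> int) x1 x2 y1 y2 :
  (forall i j, 0 <= f i j) -> x1 <= x2 -> y1 <= y2 ->
  0 <= boxsum f x1 x2 y1 y2 /\
  (boxsum f x1 x2 y1 y2 = 0 <->
   forall i j, x1 <= i < x2 -> y1 <= j < y2 -> f i j = 0).
Proof.
move=> f0 x12 y12.
have xE : x2 = x1 + `|x2 - x1|%:Z by lia.
have yE : y2 = y1 + `|y2 - y1|%:Z by lia.
rewrite {1 2}xE {1 2}yE boxsum_nat pair_big /=; split; first exact: sumr_ge0.
split=> [/eqP|fE]; last first.
  by apply: big1 => -[i j] _ /=; apply: fE; have := ltn_ord i; have := ltn_ord j; lia.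
rewrite psumr_eq0 // => /allP h i j hi hj.
have i_lt : (`|i - x1| < `|x2 - x1|)%N by lia.
have j_lt : (`|j - y1| < `|y2 - y1|)%N by lia.
have /eqP := h (Ordinal i_lt, Ordinal j_lt) (mem_index_enum _).
have <- : i = x1 + `|i - x1|%:Z by lia.
by have <- : j = y1 + `|j - y1|%:Z by lia.
Qed.

(** Starting at [P + 1], the half-open ranges run over the integral points of the open rectangle. *)
Definition interior_count (s : int * int -> bool) (P Q : int * int) : int :=
  boxsum (fun i j => (s (i, j))%:R) (P.1 + 1) Q.1 (P.2 + 1) Q.2.

Lemma interior_count_ge0 s P Q : below P Q -> 0 <= interior_count s P Q.
Proof.
by case/andP=> h1 h2; apply: (boxsumP _ _ _).1 => [i j||]; rewrite ?ler0n //; lia.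
Qed.

Lemma meets_interiorE x r : below (corner_ll r) (corner_ur r) ->
  ~~ meets_interior q x r = (interior_count (on x) (corner_ll r) (corner_ur r) == 0).
Proof.
move=> /andP[h1 h2]; set P := corner_ll r in h1 h2 *; set Q := corner_ur r in h1 h2 *.
have [||| _ zE] := @boxsumP (fun i j => (on x (i, j))%:R) (P.1 + 1) Q.1 (P.2 + 1) Q.2.
- by move=> i j; rewrite ler0n.
- by lia.
- by lia.
apply/idP/eqP.
  move=> hm; apply/zE => i j hi hj; case: (boolP (on x (i, j))) => // /existsP[l hl].
  case/negP: hm; move: h1 h2 hi hj hl; rewrite /P /Q /= => h1 h2 hi hj hl.
  have i_lt : (`|i - (ra r)%:Z| < rw r)%N by lia.
  have j_lt : (`|j - (rb r)%:Z| < rh r)%N by lia.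
  apply/existsP; exists (Ordinal i_lt); apply/existsP; exists (Ordinal j_lt).
  apply/existsP; exists l => /=; apply/and3P; split; [lia | lia |].
  rewrite /same_point /= !PoszD.
  have <- : i = (ra r)%:Z + `|i - (ra r)%:Z|%:Z by lia.
  by have <- : j = (rb r)%:Z + `|j - (rb r)%:Z|%:Z by lia.
move/zE=> h; apply/negP => /existsP[s /existsP[t /existsP[l /and3P[s0 t0 e]]]].
have := h ((ra r)%:Z + s%:Z) ((rb r)%:Z + t%:Z).
have -> : on x ((ra r)%:Z + s%:Z, (rb r)%:Z + t%:Z).
  by apply/existsP; exists l; rewrite /eqpt /= -!PoszD.
by rewrite /P /Q /=; have := ltn_ord s; have := ltn_ord t; lia.
Qed.

(** * Gradings *)

Lemma dvd_mulN d k : (N%:Z %| d * n%:Z - k * n%:Z)%Z = (p%:Z %| d - k)%Z.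
Proof. by rewrite -mulrBl PoszM dvdz_mul2r //; lia. Qed.

Lemma dvd_residue (d : int) (k : 'I_p) : (p%:Z %| d - k%:Z)%Z = (k == residue hp d).
Proof.
have h := residue_dvd hp d.
apply/idP/eqP => [h'|->//]; apply/val_inj => /=; apply: (@dvd_small p) => //.
  exact: ltn_ord (residue hp d).
rewrite -[X in (_ %| X)%Z](_ : (d - (residue hp d)%:Z) - (d - k%:Z) = _); last by ring.
exact: rpredB.
Qed.

Lemma sum_bool_residue d : \sum_(k < p) (p%:Z %| d - k%:Z)%Z%:R = 1 :> int.
Proof.
rewrite (bigD1 (residue hp d)) // dvd_residue eqxx big1 ?addr0 // => k.
by rewrite dvd_residue => /negbTE ->.
Qed.

Lemma sum_shift2 v :
  \sum_(k < p) (N%:Z %| v - (n * k)%N%:Z)%Z%:R = (n%:Z %| v)%Z%:R :> int.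
Proof.
case: (boolP (n%:Z %| v)%Z) => [/dvdzP[d ->]|nv].
  rewrite -[RHS](sum_bool_residue d); apply: eq_bigr => k _.
  by rewrite mulnC [X in _ - X]PoszM dvd_mulN.
apply: big1 => k _; apply/eqP; rewrite pnatr_eq0 eqb0; apply: contra nv => h.
rewrite -[v](subrK (n * k)%N%:Z) rpredD //; last by rewrite PoszM dvdz_mulr.
by apply: dvdz_trans h; rewrite PoszM dvdz_mull.
Qed.

(** Multiplication by [q] is invertible modulo [p], with the Bezout coefficient [b] as inverse; this
    singles out the only contributing [k]. *)
Lemma sum_shift1 u :
  \sum_(k < p) (N%:Z %| u - (n * q * k)%N%:Z)%Z%:R = (n%:Z %| u)%Z%:R :> int.
Proof.
case: (boolP (n%:Z %| u)%Z) => [/dvdzP[d ->]|nu].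
  have /coprimezP[[a b] /= ab] : coprimez p q by [].
  rewrite -[RHS](sum_bool_residue (d * b)); apply: eq_bigr => k _; congr (nat_of_bool _)%:R.
  rewrite (_ : (n * q * k)%N%:Z = (q%:Z * k%:Z) * n%:Z); last by rewrite !PoszM; ring.
  rewrite dvd_mulN; apply/idP/idP => h.
    rewrite (_ : _ - _ = (d - q%:Z * k%:Z) * b - (k%:Z * a) * p%:Z).
      by apply: rpredB; [exact: dvdz_mulr|exact: dvdz_mull].
    by rewrite -[in LHS](mulr1 k%:Z) -ab; ring.
  rewrite (_ : _ - _ = (d * b - k%:Z) * q%:Z + (d * a) * p%:Z).
    by apply: rpredD; [exact: dvdz_mulr|exact: dvdz_mull].
  by rewrite -[in LHS](mulr1 d) -ab; ring.
apply: big1 => k _; apply/eqP; rewrite pnatr_eq0 eqb0; apply: contra nu => h.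
rewrite -[u](subrK (n * q * k)%N%:Z) rpredD //; last by rewrite !PoszM -mulrA dvdz_mulr.
by apply: dvdz_trans h; rewrite PoszM dvdz_mull.
Qed.

(** The lattice is the disjoint union of the [p] cosets of $(pn\mathbb{Z})^2$ through the vectors
    $k(nq,n)$. Hence counting lifts with both coordinates modulo [pn] is counting points modulo the
    lattice. *)
Lemma sum_shift_lattice u v :
  \sum_(k < p) (N%:Z %| u - (n * q * k)%N%:Z)%Z%:R *
               (N%:Z %| v - (n * k)%N%:Z)%Z%:R = (L u v)%:R :> int.
Proof.
case: (boolP (n%:Z %| v)%Z) => [/dvdzP[d vE]|nv].
  have termE (k : 'I_p) : (N%:Z %| v - (n * k)%N%:Z)%Z = (k == residue hp d).
    by rewrite vE mulnC [X in _ - X]PoszM dvd_mulN dvd_residue.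
  rewrite (bigD1 (residue hp d)) // termE eqxx mulr1 big1; last first.
    by move=> k; rewrite termE => /negbTE ->; rewrite mulr0.
  rewrite [LHS]addr0; congr (nat_of_bool _)%:R; rewrite /in_lattice vE dvdz_mull // mulzK /=; last by lia.
  set k0 := residue hp d; have /dvdzP[e dE] := residue_dvd hp d.
  rewrite -[in RHS](subrK k0%:Z d) dE; apply/idP/idP => h.
    rewrite (_ : _ - _ = (u - (n * q * k0)%N%:Z) - (e * q%:Z) * N%:Z).
      by apply: rpredB => //; exact: dvdz_mull.
    by rewrite !PoszM; ring.
  rewrite (_ : _ - _ = (u - (e * p%:Z + k0%:Z) * (q * n)%N%:Z) + (e * q%:Z) * N%:Z).
    by apply: rpredD => //; exact: dvdz_mull.
  by rewrite !PoszM; ring.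
rewrite [L u v](_ : _ = false); last by rewrite /in_lattice (negbTE nv).
apply: big1 => k _; rewrite [X in _ * X](_ : _ = 0) ?mulr0 //.
apply/eqP; rewrite pnatr_eq0 eqb0; apply: contra nv => h.
rewrite -[v](subrK (n * k)%N%:Z) rpredD //; last by rewrite PoszM dvdz_mulr.
by apply: dvdz_trans h; rewrite PoszM dvdz_mull.
Qed.

(** * Comparison of residues modulo pn *)

(** The indicator of [a %% N <= t] drops when [a] leaves a number congruent to [t], and jumps back
    at multiples of [N], where the quotient compensates it. *)
Lemma le_residue_step (a t : int) : 0 <= t < N%:Z ->
  ((a + 1) %% N%:Z <= t)%Z%:R - ((a + 1) %/ N%:Z)%Z
   = (a %% N%:Z <= t)%Z%:R - (a %/ N%:Z)%Z - (N%:Z %| a - t)%Z%:R :> int.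
Proof.
move: N_gt0; move: N => M M0 ht.
have M0' : M%:Z != 0 by lia.
have aE := divz_eq a M%:Z; have hr := residue_bounds a M0.
move: (a %/ M%:Z)%Z (a %% M%:Z)%Z aE hr => d r -> hr {a}.
have -> : (M%:Z %| d * M%:Z + r - t)%Z = (r == t).
  rewrite -addrA; apply/idP/eqP => [h|->]; last by rewrite subrr addr0 dvdz_mull.
  have : (M%:Z %| r - t)%Z.
    by rewrite -[r - t](addKr (d * M%:Z)) rpredD // rpredN dvdz_mull.
  by case/dvdzP=> -[[|e]|e]; nia.
rewrite -addrA !modzMDl !divzMDl //.
have [rM|rM] := eqVneq (r + 1) M%:Z.
  rewrite rM modzz divzz M0'; have rE : r = M%:Z - 1 by lia.
  by case: (ltgtP r t) => ?; lia.
rewrite modz_small ?divz_small; [|lia..].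
by case: (ltgtP r t) => ?; lia.
Qed.

Lemma le_residue a b t : 0 <= t < N%:Z ->
  (a %% N%:Z <= t)%Z%:R - (b %% N%:Z <= t)%Z%:R =
  isum (fun i => (N%:Z %| i - t)%Z%:R) a b - ((b %/ N%:Z)%Z - (a %/ N%:Z)%Z) :> int.
Proof.
move=> ht; rewrite (@isum_eq _ (fun c => (c %/ N%:Z)%Z - (c %% N%:Z <= t)%Z%:R)); first ring.
move=> c /=; have /eqP := le_residue_step c ht.
rewrite -subr_eq0 => /eqP h; apply/eqP; rewrite -subr_eq0 -oppr_eq0 -[X in _ == X]h.
by apply/eqP; ring.
Qed.

(** For a strict inequality the drop takes place on reaching [t] instead of leaving it, whence the
    bounds shifted by 1. *)
Lemma lt_residue a b t : 0 <= t < N%:Z ->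
  (a %% N%:Z < t)%Z%:R - (b %% N%:Z < t)%Z%:R =
  isum (fun i => (N%:Z %| i - t)%Z%:R) (a + 1) (b + 1)
   - ((b %/ N%:Z)%Z - (a %/ N%:Z)%Z) :> int.
Proof.
move=> ht; have lt_le c : (c %% N%:Z < t)%Z%:R
    = (c %% N%:Z <= t)%Z%:R - (N%:Z %| c - t)%Z%:R :> int.
  rewrite -eqz_mod_dvd (modz_small ht).
  by case: ltgtP.
have /eqP := le_residue a b ht; rewrite -subr_eq0 !lt_le /isum !primS => /eqP h.
by apply/eqP; rewrite -subr_eq0 -[X in _ == X]h; apply/eqP; ring.
Qed.

(** * Sums over lifted points *)

Definition ptz (c : nat * nat) : int * int := (c.1%:Z, c.2%:Z).

Definition lift_sum (c : 'I_n -> nat * nat) (g : int -> int -> int) : int :=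
  \sum_(s : 'I_n * 'I_p) g (lift_point q c s).1%:Z (lift_point q c s).2%:Z.

Definition orbit_sum (g : int -> int -> int) (T : int * int) : int :=
  \sum_(k < p) g ((T.1 + (n * q * k)%N%:Z) %% N%:Z)%Z ((T.2 + (n * k)%N%:Z) %% N%:Z)%Z.

Lemma lift_point_bounds (c : 'I_n -> nat * nat) (s : 'I_n * 'I_p) : ((c s.1).2 < n)%N ->
  ((lift_point q c s).1 < N)%N /\ ((lift_point q c s).2 < N)%N.
Proof.
case: s => l k /= hc; split; first by rewrite [X in (_ < X)%N]mulnC ltn_pmod // mulnC N_gt0.
have := ltn_ord k; nia.
Qed.

Lemma lift_point1 (c : 'I_n -> nat * nat) (l : 'I_n) (k : 'I_p) :
  (lift_point q c (l, k)).1%:Z = (((c l).1%:Z + (n * q * k)%N%:Z) %% N%:Z)%Z.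
Proof. by rewrite /lift_point /= -modz_nat PoszD [(n * p)%N]mulnC. Qed.

Lemma lift_sumE c g : (forall l, ((c l).2 < n)%N) ->
  lift_sum c g = \sum_l orbit_sum g (ptz (c l)).
Proof.
move=> hc; rewrite pair_big; apply: eq_bigr => -[l k] _; rewrite lift_point1.
congr g; rewrite /= -PoszD modz_nat modn_small //.
exact: (@lift_point_bounds c (l, k) (hc l)).2.
Qed.

(** The summand is [p]-periodic in [k], and adding the lattice vector with coefficients [s], [t] to
    the point replaces [k] by [k + t], which does not affect a sum over a period. *)
Lemma orbit_sum_inv g T U : eqpt T U -> orbit_sum g T = orbit_sum g U.
Proof.
move=> /in_latticeP[s [t [h1 h2]]].
pose h (k : int) := g ((U.1 + (n * q)%N%:Z * k) %% N%:Z)%Z ((U.2 + n%:Z * k) %% N%:Z)%Z.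
have hper k : h (k + p%:Z) = h k.
  rewrite /h; congr g; apply/eqP; rewrite eqz_mod_dvd.
    by apply/dvdzP; exists q%:Z; rewrite !PoszM; ring.
  by apply/dvdzP; exists 1; rewrite !PoszM; ring.
have per t' : isum h t' (t' + p%:Z) = isum h 0 p%:Z.
  rewrite -[p%:Z in RHS]add0r.
  apply: (@int_step_const _ (fun t' => isum h t' (t' + p%:Z))) => a.
  by rewrite addrAC /isum !primS hper; ring.
have uE : orbit_sum g U = isum h 0 p%:Z.
  rewrite -[p%:Z]add0r isum_nat; apply: eq_bigr => k _.
  by rewrite /h add0r !PoszM.
rewrite uE -(per t) isum_nat; apply: eq_bigr => k _; rewrite /h.
congr g; apply/eqP; rewrite eqz_mod_dvd.
  have -> : T.1 = U.1 + (s * (p * n)%N + t * (q * n)%N) by rewrite -h1; ring.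
  by apply/dvdzP; exists s; rewrite !PoszM; ring.
have -> : T.2 = U.2 + t * n by rewrite -h2; ring.
by apply/dvdzP; exists 0; rewrite !PoszM; ring.
Qed.

(** Outside the two rows of the rectangle the points of [x] and [y] are equivalent, which leaves the
    mixed difference over the corners. *)
Lemma sum_gpt_swp (phi : int * int -> int) x y P Q :
  (forall T U, eqpt T U -> phi T = phi U) ->
  on x P -> on x Q -> ~~ cg P.2 Q.2 -> (forall T, on y T = swp (on x) P Q T) ->
  \sum_l phi (gpt x l) - \sum_l phi (gpt y l)
    = phi P + phi Q - phi (Q.1, P.2) - phi (P.1, Q.2).
Proof.
move=> inv /existsP[l1 xP] /existsP[l2 xQ] ne yE.
have l1E := eqpt_cg2 xP; have l2E := eqpt_cg2 xQ.
have l21 : l2 != l1.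
  by apply: contra ne => /eqP l12; rewrite (cgl _ l1E) (cgr _ l2E) l12 cg_refl.
rewrite (bigD1 l1) //= [X in _ - X](bigD1 l1) //=.
rewrite (bigD1 l2) //= [X in _ - (_ + X)](bigD1 l2) //=.
have y1 : eqpt (Q.1, P.2) (gpt y l1).
  by apply: on_row => //; rewrite yE /swp /= cg_refl eqpt_refl.
have y2 : eqpt (P.1, Q.2) (gpt y l2).
  by apply: on_row => //; rewrite yE /swp /= cg_sym (negbTE ne) cg_refl eqpt_refl.
rewrite -(inv _ _ xP) -(inv _ _ xQ) -(inv _ _ y1) -(inv _ _ y2).
rewrite [X in phi P + (phi Q + X)](eq_bigr (fun l => phi (gpt y l))); first ring.
move=> l /andP[ll1 ll2]; apply: inv; rewrite eqpt_sym; apply: on_row; rewrite ?cg_refl //.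
have : on y (gpt y l) by apply: on_gpt.
rewrite yE /swp (cgr _ l1E) (cgr _ l2E) !gpt2.
case: ifP => [/cg_ord/eqP|_]; first by rewrite (negbTE ll1).
by case: ifP => [/cg_ord/eqP|_]; first by rewrite (negbTE ll2).
Qed.

(** The property common to generators and sets of markings, put in the form of sums of indicators
    because it is applied under sums over lifts. *)
Definition transversal (c : 'I_n -> nat * nat) : Prop :=
  [/\ forall l, ((c l).2 < n)%N,
      forall i, \sum_l (cg i (c l).1%:Z)%:R = 1 :> int &
      forall j, \sum_l (cg j (c l).2%:Z)%:R = 1 :> int].

Lemma dvd_sub_mod i a : (N%:Z %| i - (a %% N%:Z)%Z)%Z = (N%:Z %| i - a)%Z.
Proof. by rewrite -!eqz_mod_dvd modz_mod. Qed.

Lemma lift_point2 (c : 'I_n -> nat * nat) (l : 'I_n) (k : 'I_p) :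
  (lift_point q c (l, k)).2%:Z = (c l).2%:Z + (n * k)%N%:Z.
Proof. by rewrite /= PoszD. Qed.

Lemma lift_sum_col c i : transversal c ->
  lift_sum c (fun t1 _ => (N%:Z %| i - t1)%Z%:R) = 1.
Proof.
case=> _ h _; rewrite -[RHS](h i).
transitivity (\sum_l \sum_(k < p)
    (N%:Z %| i - (lift_point q c (l, k)).1%:Z)%Z%:R : int); first by rewrite pair_big; apply: eq_bigr => -[].
apply: eq_bigr => l _.
rewrite -[RHS]sum_shift1; apply: eq_bigr => k _.
by rewrite lift_point1 dvd_sub_mod opprD addrA.
Qed.

Lemma lift_sum_row c j : transversal c ->
  lift_sum c (fun _ t2 => (N%:Z %| j - t2)%Z%:R) = 1.
Proof.
case=> _ _ h; rewrite -[RHS](h j).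
transitivity (\sum_l \sum_(k < p)
    (N%:Z %| j - (lift_point q c (l, k)).2%:Z)%Z%:R : int); first by rewrite pair_big; apply: eq_bigr => -[].
apply: eq_bigr => l _.
rewrite -[RHS]sum_shift2; apply: eq_bigr => k _.
by rewrite lift_point2 opprD addrA.
Qed.

Lemma lift_sum_box c i j :
  lift_sum c (fun t1 t2 => (N%:Z %| i - t1)%Z%:R * (N%:Z %| j - t2)%Z%:R)
  = \sum_l at_pt (ptz (c l)) i j.
Proof.
transitivity (\sum_l \sum_(k < p)
    (N%:Z %| i - (lift_point q c (l, k)).1%:Z)%Z%:R *
    (N%:Z %| j - (lift_point q c (l, k)).2%:Z)%Z%:R : int); first by rewrite pair_big; apply: eq_bigr => -[].
apply: eq_bigr => l _.
rewrite -[RHS]sum_shift_lattice; apply: eq_bigr => k _.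
by rewrite lift_point1 lift_point2 dvd_sub_mod !opprD !addrA.
Qed.

(* The reduction of [a, b) modulo N jumps back wraps a b times.  The resulting
   corrections only depend on the rectangle, not on the points that are counted,
   so that they cancel in the gradings. *)
Definition wraps (a b : int) : int := (b %/ N%:Z)%Z - (a %/ N%:Z)%Z.

Definition wrap_correction (P Q : int * int) : int :=
  wraps P.2 Q.2 * (Q.1 - P.1) + wraps P.1 Q.1 * (Q.2 - P.2)
  - wraps P.1 Q.1 * wraps P.2 Q.2 * N%:Z.

Definition shift (P : int * int) (u v : int) := (P.1 + u, P.2 + v).

(** [K] compares a moving coordinate with [t]: up to wraps, its variation counts the passages
    through [t]. The offset [e] is 1 if the passage occurs on reaching [t], and 0 if on leaving
    it. *)
Definition step_kernel (K : int -> int -> int) (e : int) : Prop :=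
  forall a b t, 0 <= t < N%:Z ->
  K (a %% N%:Z)%Z t - K (b %% N%:Z)%Z t =
  isum (fun i => (N%:Z %| i - t)%Z%:R) (a + e) (b + e) - wraps a b.

Lemma lift_sumD c f g :
  lift_sum c (fun i j => f i j + g i j) = lift_sum c f + lift_sum c g.
Proof. exact: big_split. Qed.

Lemma lift_sumZ c f k :
  lift_sum c (fun i j => f i j * k) = lift_sum c f * k.
Proof. by rewrite /lift_sum mulr_suml. Qed.

Lemma lift_sum1 c : lift_sum c (fun _ _ => 1) = N%:Z.
Proof.
by rewrite /lift_sum sumr_const card_prod !card_ord natz mulnC.
Qed.

Lemma lift_sum_eq c f g : (forall l, ((c l).2 < n)%N) ->
  (forall i j, 0 <= i < N%:Z -> 0 <= j < N%:Z -> f i j = g i j) ->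
  lift_sum c f = lift_sum c g.
Proof.
move=> hc fg; apply: eq_bigr => s _; apply: fg.
  by have [] := @lift_point_bounds c s (hc _); lia.
by have [] := @lift_point_bounds c s (hc _); lia.
Qed.

(** Each factor is a number of passages minus wraps. In the expanded product, the product of
    passages counts the points in the box, while a single number of passages sums to a side length,
    since each abscissa and each ordinate modulo [pn] carries one lift. *)
Lemma kernel_box c K e P Q : transversal c -> step_kernel K e ->
  lift_sum c (fun t1 t2 => (K (P.1 %% N%:Z)%Z t1 - K (Q.1 %% N%:Z)%Z t1) *
                           (K (P.2 %% N%:Z)%Z t2 - K (Q.2 %% N%:Z)%Z t2))
  = \sum_l area (at_pt (ptz (c l))) (shift P e e) (shift Q e e) - wrap_correction P Q.
Proof.
move=> hc hK; have [c2 _ _] := hc.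
pose d t i : int := (N%:Z %| i - t)%Z%:R.
have -> : lift_sum c (fun t1 t2 => (K (P.1 %% N%:Z)%Z t1 - K (Q.1 %% N%:Z)%Z t1) *
                           (K (P.2 %% N%:Z)%Z t2 - K (Q.2 %% N%:Z)%Z t2))
 = lift_sum c (fun t1 t2 => isum (d t1) (P.1 + e) (Q.1 + e) * isum (d t2) (P.2 + e) (Q.2 + e)
     + isum (d t1) (P.1 + e) (Q.1 + e) * (- wraps P.2 Q.2)
     + isum (d t2) (P.2 + e) (Q.2 + e) * (- wraps P.1 Q.1)
     + 1 * (wraps P.1 Q.1 * wraps P.2 Q.2)).
  by apply: lift_sum_eq => // i j hi hj; rewrite !hK //; rewrite /d; ring.
rewrite !lift_sumD !lift_sumZ lift_sum1.
have -> : lift_sum c (fun i _ => isum (d i) (P.1 + e) (Q.1 + e)) = Q.1 - P.1.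
  rewrite /lift_sum -(isum_sum (fun s => d (lift_point q c s).1%:Z)).
  rewrite (@isum_eq _ id) //=; first ring.
  by move=> i; rewrite -(lift_sum_col i hc).
have -> : lift_sum c (fun _ i => isum (d i) (P.2 + e) (Q.2 + e)) = Q.2 - P.2.
  rewrite /lift_sum -(isum_sum (fun s => d (lift_point q c s).2%:Z)).
  rewrite (@isum_eq _ id) //=; first ring.
  by move=> i; rewrite -(lift_sum_row i hc).
have -> : lift_sum c (fun i j => isum (d i) (P.1 + e) (Q.1 + e) * isum (d j) (P.2 + e) (Q.2 + e))
   = \sum_l area (at_pt (ptz (c l))) (shift P e e) (shift Q e e).
  rewrite -boxsum_sum /lift_sum; under eq_bigr do rewrite -boxsum_prod.
  by rewrite -boxsum_sum; apply: boxsum_ext => i j; rewrite -lift_sum_box.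
by rewrite /wrap_correction; ring.
Qed.

Lemma at_pt_shift c u v i j : L u v -> at_pt c (i + u) (j + v) = at_pt c i j.
Proof. by move=> h; rewrite /at_pt -(eqpt_shift (i, j) c h). Qed.

Lemma area_shift c u v P Q : L u v ->
  area (at_pt c) (shift P u v) (shift Q u v) = area (at_pt c) P Q.
Proof. by move=> h; apply: boxsum_shift => i j; apply: at_pt_shift. Qed.

Lemma lattice_step (k : nat) : L (n * q * k)%N%:Z (n * k)%N%:Z.
Proof.
by apply/in_latticeP; exists 0, k%:Z; rewrite !PoszM; split; ring.
Qed.

Definition total_correction (P Q : int * int) : int :=
  \sum_(k < p) wrap_correction (shift P (n * q * k)%N%:Z (n * k)%N%:Z)
                               (shift Q (n * q * k)%N%:Z (n * k)%N%:Z).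

(* x and y differ by p boxes, translates of one another; on each of them the
   difference is a product measure, which reduces the count to one coordinate. *)
Definition kernel_sum (c : 'I_n -> nat * nat) (K : int -> int -> int) (i j : int) :=
  lift_sum c (fun t1 t2 => K i t1 * K j t2).

(** The mixed difference of [K i t1 * K j t2] over the corners factors as in [kernel_box], for each
    of the [p] translates of the rectangle. The areas of these translates coincide, whence the
    factor [p], but their wrap corrections may differ and are summed. *)
Lemma kernel_swp c K e x y P Q : transversal c -> step_kernel K e ->
  on x P -> on x Q -> ~~ cg P.2 Q.2 -> (forall T, on y T = swp (on x) P Q T) ->
  lift_sum (gpoint x) (kernel_sum c K) - lift_sum (gpoint y) (kernel_sum c K) =
  p%:Z * (\sum_l area (at_pt (ptz (c l))) (shift P e e) (shift Q e e))
  - total_correction P Q.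
Proof.
move=> hc hK xP xQ ne yE.
have row_lt (z : gen n p) (l : 'I_n) : ((gpoint z l).2 < n)%N by exact: ltn_ord.
rewrite !lift_sumE //.
rewrite (sum_gpt_swp (phi := orbit_sum (kernel_sum c K)) _ xP xQ ne yE); last exact: orbit_sum_inv.
rewrite -big_split -!sumrB /=.
pose a := \sum_l area (at_pt (ptz (c l))) (shift P e e) (shift Q e e).
transitivity (\sum_(k < p) (a - wrap_correction (shift P (n * q * k)%N%:Z (n * k)%N%:Z)
                               (shift Q (n * q * k)%N%:Z (n * k)%N%:Z))); last first.
  by rewrite sumrB sumr_const card_ord -mulr_natl natz.
apply: eq_bigr => k _.
set P' := shift P _ _; set Q' := shift Q _ _.
have -> : a = \sum_l area (at_pt (ptz (c l))) (shift P' e e) (shift Q' e e).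
  apply: eq_bigr => l _; rewrite -[LHS](area_shift _ _ _ (lattice_step k)).
  by rewrite /shift /= ![_ + e + _]addrAC.
rewrite -(kernel_box _ _ hc hK) /P' /Q' /kernel_sum /= /lift_sum.
rewrite -big_split -!sumrB /=; apply: eq_bigr => s _; ring.
Qed.

Lemma sum_bool_unique (I : finType) (b : I -> bool) (i0 : I) :
  (forall i, b i = (i == i0)) -> \sum_i (b i)%:R = 1 :> int.
Proof.
move=> bE; rewrite (bigD1 i0) // bE eqxx big1 ?addr0 // => i /negbTE h.
by rewrite bE h.
Qed.

Lemma ord_cg_sum (f : 'I_n -> nat) (j : int) :
  (forall l : 'I_n, exists! i, (f i %% n)%N = l) -> \sum_i (cg j (f i)%:Z)%:R = 1 :> int.
Proof.
move=> hf; have [l hl] := cg_ex j; have [i0 [fi0 i0_uniq]] := hf l.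
have mE i : cg (f i)%:Z (f i %% n)%N%:Z.
  by rewrite {1}(divn_eq (f i) n) cgMD cg_refl.
apply: (sum_bool_unique (i0 := i0)) => i; rewrite (cgl _ hl) (cgr _ (mE i)).
apply/idP/eqP => [h|->]; last by rewrite fi0 cg_refl.
by symmetry; apply: i0_uniq; rewrite (@cg_ord l (Ordinal (ltn_pmod (f i) hn)) h).
Qed.

Lemma transversal_gen (x : gen n p) : transversal (gpoint x).
Proof.
split=> [l|i|j]; first exact: ltn_ord.
  apply: ord_cg_sum => l; exists (x.1^-1 l)%g; split.
    by rewrite /gpoint /= modnMDl permKV modn_small.
  by move=> l'; rewrite /gpoint /= modnMDl modn_small // => /val_inj <-; rewrite permK.
apply: ord_cg_sum => l; exists l; split; first by rewrite /= modn_small.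
by move=> l'; rewrite /= modn_small // => /val_inj.
Qed.

Lemma transversal_mark (m : 'I_n -> square n p) :
  one_per_row_and_column m -> transversal (fun i => corner (m i)).
Proof.
case=> hr hc; split=> [l|i|j]; first exact: ltn_ord.
  by apply: ord_cg_sum => l; exact: hc.
apply: ord_cg_sum => l; have [i0 [h1 h2]] := hr l; exists i0; split.
  by rewrite /corner /= modn_small.
by move=> i'; rewrite /corner /= modn_small // => h; apply: h2.
Qed.

(** * The counts of pairs as kernel sums *)

Definition klt (i t : int) : int := (i < t)%R%:R.
Definition kle (i t : int) : int := (i <= t)%R%:R.
(** With this sign [kgt] is [kle] minus 1 and satisfies the same step relation; in a product of two
    factors the signs cancel. *)
Definition kgt (i t : int) : int := - (t < i)%R%:R.

Lemma step_klt : step_kernel klt 1.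
Proof. by move=> a b t; exact: lt_residue. Qed.

Lemma step_kle : step_kernel kle 0.
Proof. by move=> a b t; rewrite !addr0; exact: le_residue. Qed.

Lemma step_kgt : step_kernel kgt 0.
Proof.
move=> a b t ht; rewrite -(step_kle _ _ ht) /kgt /kle.
by case: (ltrP t (a %% N%:Z)%Z); case: (ltrP t (b %% N%:Z)%Z).
Qed.

Lemma IcountE (A B : 'I_n * 'I_p -> rat * rat) (a b : 'I_n * 'I_p -> nat * nat)
    (K : int -> int -> int) :
  (forall s t, ((A s).1 < (B t).1)%R%:R = K (a s).1%:Z (b t).1%:Z) ->
  (forall s t, ((A s).2 < (B t).2)%R%:R = K (a s).2%:Z (b t).2%:Z) ->
  (Icount A B)%:Z =
  \sum_s \sum_t K (a s).1%:Z (b t).1%:Z * K (a s).2%:Z (b t).2%:Z.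
Proof.
move=> h1 h2; rewrite /Icount -sum1_card big_mkcond /= -natz natr_sum pair_big /=.
apply: eq_bigr => -[s t] _; rewrite inE /= -h1 -h2.
by case: (_ < _); case: (_ < _).
Qed.

Lemma Icount_gen_gen (x y : gen n p) :
  (Icount (lift_gen q x) (lift_gen q y))%:Z =
  lift_sum (gpoint x) (kernel_sum (gpoint y) klt).
Proof.
by apply: IcountE => s t; rewrite /lift_gen /= ltr_nat /klt ltz_nat.
Qed.

Lemma ltr_nat_half (i j : nat) : (i%:R < j%:R + 2^-1 :> rat) = (i <= j)%N.
Proof.
case: leqP => h.
  have : (i%:R <= j%:R :> rat) by rewrite ler_nat.
  lra.
have : (j.+1%:R <= i%:R :> rat) by rewrite ler_nat.
rewrite -natr1 => h'; apply/negbTE; rewrite -leNgt; lra.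
Qed.

Lemma ltr_half_nat (i j : nat) : (i%:R + 2^-1 < j%:R :> rat) = (i < j)%N.
Proof.
case: ltnP => h.
  have : (i.+1%:R <= j%:R :> rat) by rewrite ler_nat.
  by rewrite -natr1; lra.
have : (j%:R <= i%:R :> rat) by rewrite ler_nat.
by move=> h'; apply/negbTE; rewrite -leNgt; lra.
Qed.

Lemma Icount_gen_mark (x : gen n p) (m : 'I_n -> square n p) :
  (Icount (lift_gen q x) (lift_mark q m))%:Z =
  lift_sum (gpoint x) (kernel_sum (fun i => corner (m i)) kle).
Proof.
by apply: IcountE => s t; rewrite /lift_gen /lift_mark /= ltr_nat_half /kle lez_nat.
Qed.

Lemma Icount_mark_gen (m : 'I_n -> square n p) (x : gen n p) :
  (Icount (lift_mark q m) (lift_gen q x))%:Z =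
  lift_sum (gpoint x) (kernel_sum (fun i => corner (m i)) kgt).
Proof.
rewrite /kernel_sum /lift_sum exchange_big /=.
rewrite (@IcountE _ _ (lift_point q (fun i => corner (m i))) (lift_point q (gpoint x))
          (fun t i => (t < i)%R%:R)); last 2 first.
- by move=> s t; rewrite /lift_gen /lift_mark /= ltr_half_nat ltz_nat.
- by move=> s t; rewrite /lift_gen /lift_mark /= ltr_half_nat ltz_nat.
by apply: eq_bigr => s _; apply: eq_bigr => t _; rewrite /kgt mulrNN.
Qed.

Lemma sum_at_gpt x i j : \sum_l at_pt (ptz (gpoint x l)) i j = (on x (i, j))%:R.
Proof.
case: (boolP (on x (i, j))) => [/[dup] xT /existsP[l hl]|nx].
  apply: (sum_bool_unique (i0 := l)) => l'; apply/idP/eqP => [h|->//].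
  by apply: cg_ord; rewrite -(cgl _ (eqpt_cg2 h)) (eqpt_cg2 hl).
apply: big1 => l _; apply/eqP; rewrite pnatr_eq0 eqb0.
by apply: contra nx => h; apply/existsP; exists l.
Qed.

(** * Points of a generator on the sides of a rectangle *)

Lemma state_row_dvd s i i' j : is_state s -> s (i, j) -> s (i', j) -> (N%:Z %| i - i')%Z.
Proof.
by move=> hs h h'; rewrite -lattice_row -(subrr j); apply: (st_row hs h h'); rewrite cg_refl.
Qed.

Lemma state_col_dvd s i j j' : is_state s -> s (i, j) -> s (i, j') -> (N%:Z %| j - j')%Z.
Proof.
by move=> hs h h'; rewrite -lattice_col -(subrr i); apply: (st_col hs h h'); rewrite cg_refl.
Qed.

Lemma dvd_lt (M : nat) (d : int) : (M%:Z %| d)%Z -> 0 < d -> M%:Z <= d.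
Proof. by case/dvdzP=> -[[|k]|k]; nia. Qed.

Lemma boxsum1 f a b : boxsum f a (a + 1) b (b + 1) = f a b.
Proof. by rewrite (boxsum_nat f a b 1 1) !big_ord1 !addr0. Qed.

Lemma boxsum_state0 s x1 x2 y1 y2 : x1 <= x2 -> y1 <= y2 ->
  (forall i j, x1 <= i < x2 -> y1 <= j < y2 -> ~~ s (i, j)) ->
  boxsum (fun i j => (s (i, j))%:R) x1 x2 y1 y2 = 0.
Proof.
move=> hx hy h; apply: (boxsumP _ hx hy).2.2 => [i j|i j hi hj].
  by rewrite ler0n.
by rewrite (negbTE (h i j hi hj)).
Qed.

(** The box shifted by 1 contains the upper and right sides, except their ends [(P.1, Q.2)] and
    [(Q.1, P.2)]. Points of a state on one line are a multiple of [pn] apart, so on these shorter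
    sides only [Q] is met; it gives the 1 in the variation of M. *)
Lemma area_on_upper x P Q : below P Q -> small_rect P Q -> on x Q ->
  \sum_l area (at_pt (ptz (gpoint x l))) (shift P 1 1) (shift Q 1 1)
  = 1 + interior_count (on x) P Q.
Proof.
case/andP=> h1 h2 /andP[w h] xQ; have hs := on_state x.
rewrite -boxsum_sum (boxsum_ext _ _ _ _ (sum_at_gpt x)) /interior_count /=.
have [g gE] := boxsum_potential (fun i j => (on x (i, j))%:R).
have e0 : boxsum (fun i j => (on x (i, j))%:R) (P.1 + 1) Q.1 Q.2 (Q.2 + 1) = 0.
  apply: boxsum_state0 => [||i j hi hj]; [lia|lia|].
  apply/negP => xT; have jE : j = Q.2 by lia.
  rewrite jE in xT; rewrite (surjective_pairing Q) in xQ.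
  by have /dvd_lt := state_row_dvd hs xQ xT; lia.
have e1 : boxsum (fun i j => (on x (i, j))%:R) Q.1 (Q.1 + 1) (P.2 + 1) Q.2 = 0.
  apply: boxsum_state0 => [||i j hi hj]; [lia|lia|].
  apply/negP => xT; have iE : i = Q.1 by lia.
  rewrite iE in xT; rewrite (surjective_pairing Q) in xQ.
  by have /dvd_lt := state_col_dvd hs xQ xT; lia.
have e2 := boxsum1 (fun i j => (on x (i, j))%:R) Q.1 Q.2.
rewrite -surjective_pairing xQ in e2.
by move: e0 e1 e2; rewrite !gE; lia.
Qed.

(** The unshifted box contains the lower and left sides without the ends [(Q.1, P.2)] and
    [(P.1, Q.2)]. These ends are in [y], which excludes other points of [y] on sides shorter than
    [pn]. *)
Lemma area_on_lower y P Q : below P Q -> small_rect P Q ->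
  on y (Q.1, P.2) -> on y (P.1, Q.2) ->
  \sum_l area (at_pt (ptz (gpoint y l))) (shift P 0 0) (shift Q 0 0)
  = interior_count (on y) P Q.
Proof.
case/andP=> h1 h2 /andP[w h] yS yW; have hs := on_state y.
rewrite -boxsum_sum (boxsum_ext _ _ _ _ (sum_at_gpt y)) /interior_count /= !addr0.
have [g gE] := boxsum_potential (fun i j => (on y (i, j))%:R).
have e0 : boxsum (fun i j => (on y (i, j))%:R) P.1 Q.1 P.2 (P.2 + 1) = 0.
  apply: boxsum_state0 => [||i j hi hj]; [lia|lia|].
  apply/negP => yT; have jE : j = P.2 by lia.
  by rewrite jE in yT; have /dvd_lt := state_row_dvd hs yS yT; lia.
have e1 : boxsum (fun i j => (on y (i, j))%:R) P.1 (P.1 + 1) (P.2 + 1) Q.2 = 0.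
  apply: boxsum_state0 => [||i j hi hj]; [lia|lia|].
  apply/negP => yT; have iE : i = P.1 by lia.
  by rewrite iE in yT; have /dvd_lt := state_col_dvd hs yW yT; lia.
by move: e0 e1; rewrite !gE; lia.
Qed.

(** * Variation of the three gradings *)

Section Gradings.
Variable G : grid n p.

Definition mark_area (m : 'I_n -> square n p) (P Q : int * int) : int :=
  \sum_l area (at_pt (ptz (corner (m l)))) P Q.

Lemma shift0 P : shift P 0 0 = P.
Proof. by case: P => a b; rewrite /shift /= !addr0. Qed.

(** The self-counts of [x] and [y] are compared through $\mathcal{I}(\tilde y,\tilde x)$, moving one
    argument at a time: against [x] with [klt], which yields $1+\#(x)$ in the interior, and against
    [y] with [kgt], which yields $\#(y)$. The two resulting corrections cancel those of the two
    counts with the O markings. *)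
Lemma Maslov_swp x y P Q : below P Q -> small_rect P Q ->
  on x P -> on x Q -> ~~ cg P.2 Q.2 -> (forall T, on y T = swp (on x) P Q T) ->
  Maslov q G x - Maslov q G y =
  (1 + interior_count (on x) P Q + interior_count (on y) P Q
   - 2 * mark_area (markO G) P Q)%:~R.
Proof.
move=> PQ sPQ xP xQ ne yE.
have tO := transversal_mark (markO_rowcol G).
have eq1 := kernel_swp (transversal_gen x) step_klt xP xQ ne yE.
have eq2 := kernel_swp (transversal_gen y) step_kgt xP xQ ne yE.
have eq3 := kernel_swp tO step_kle xP xQ ne yE.
have eq4 := kernel_swp tO step_kgt xP xQ ne yE.
have yS : on y (Q.1, P.2) by rewrite yE /swp /= cg_refl eqpt_refl.
have yW : on y (P.1, Q.2).
  by rewrite yE /swp /= cg_sym (negbTE ne) cg_refl eqpt_refl.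
rewrite area_on_upper // in eq1; rewrite area_on_lower // in eq2.
rewrite -/(mark_area _ _ _) !shift0 in eq3 eq4.
have eq2' : (Icount (lift_gen q y) (lift_gen q x))%:Z - (Icount (lift_gen q y) (lift_gen q y))%:Z
   = p%:Z * interior_count (on y) P Q - total_correction P Q.
  rewrite -eq2 !Icount_gen_gen /kernel_sum /lift_sum exchange_big [X in _ - X]exchange_big /=.
  by congr (_ - _); apply: eq_bigr => s _; apply: eq_bigr => t _; rewrite /klt /kgt mulrNN.
rewrite -!Icount_gen_gen in eq1; rewrite -!Icount_gen_mark in eq3.
rewrite -!Icount_mark_gen in eq4.
have p0 : (p%:R : rat) != 0 by rewrite pnatr_eq0 -lt0n.
rewrite /Maslov; apply: (mulfI p0).
rewrite [LHS](_ : _ =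
   (((Icount (lift_gen q x) (lift_gen q x))%:Z - (Icount (lift_gen q y) (lift_gen q x))%:Z)
   + ((Icount (lift_gen q y) (lift_gen q x))%:Z - (Icount (lift_gen q y) (lift_gen q y))%:Z)
   - ((Icount (lift_gen q x) (lift_mark q (markO G)))%:Z - (Icount (lift_gen q y) (lift_mark q (markO G)))%:Z)
   - ((Icount (lift_mark q (markO G)) (lift_gen q x))%:Z - (Icount (lift_mark q (markO G)) (lift_gen q y))%:Z))%:~R).
  rewrite eq1 eq2' eq3 eq4 -[p%:R]/((p%:Z)%:~R) -intrM; congr (_%:~R); ring.
rewrite !(rmorphB, rmorphD) /= -!pmulrn; field; exact: p0.
Qed.

Lemma Alexander_swp x y P Q :
  on x P -> on x Q -> ~~ cg P.2 Q.2 -> (forall T, on y T = swp (on x) P Q T) ->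
  Alexander q G x - Alexander q G y =
  (mark_area (markX G) P Q - mark_area (markO G) P Q)%:~R.
Proof.
move=> xP xQ ne yE.
have tO := transversal_mark (markO_rowcol G).
have tX := transversal_mark (markX_rowcol G).
have eq3 := kernel_swp tX step_kgt xP xQ ne yE.
have eq4 := kernel_swp tO step_kgt xP xQ ne yE.
rewrite -/(mark_area _ _ _) !shift0 in eq3 eq4.
rewrite -!Icount_mark_gen in eq3 eq4.
have p0 : (p%:R : rat) != 0 by rewrite pnatr_eq0 -lt0n.
rewrite /Alexander natrM; apply: (mulfI p0).
rewrite [LHS](_ : _ =
   (((Icount (lift_mark q (markX G)) (lift_gen q x))%:Z - (Icount (lift_mark q (markX G)) (lift_gen q y))%:Z)
   - ((Icount (lift_mark q (markO G)) (lift_gen q x))%:Z - (Icount (lift_mark q (markO G)) (lift_gen q y))%:Z))%:~R).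
  rewrite eq3 eq4 -[p%:R]/((p%:Z)%:~R) -intrM; congr (_%:~R); ring.
rewrite !(rmorphB, rmorphD) /= -!pmulrn; field; exact: p0.
Qed.

(** [phi] is the abscissa of the representative in the fundamental domain. Over a generator it sums
    to [n] times the sum of the [p]-coordinates plus a constant, the columns being permuted. Modulo
    [pn] it is a function of the abscissa plus one of the ordinate, so its mixed difference
    vanishes. *)
Lemma Spin_swp x y P Q :
  on x P -> on x Q -> ~~ cg P.2 Q.2 -> (forall T, on y T = swp (on x) P Q T) ->
  Spin q G x = Spin q G y.
Proof.
move=> xP xQ ne yE; rewrite /Spin; apply/eqP; rewrite eqz_mod_dvd.
rewrite (_ : _ - _ = \sum_(l < n) (pcoord x l)%:Z - \sum_(l < n) (pcoord y l)%:Z); last by ring.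
pose phi (T : int * int) := ((T.1 - (T.2 %/ n%:Z)%Z * (q * n)%N%:Z) %% N%:Z)%Z.
have n0 : n%:Z != 0 by lia.
have phi_inv T U : eqpt T U -> phi T = phi U.
  case/in_latticeP=> s [t [h1 h2]]; apply/eqP; rewrite eqz_mod_dvd.
  have -> : T.2 = t * n%:Z + U.2 by rewrite -h2; ring.
  rewrite divzMDl //; apply/dvdzP; exists s.
  have -> : T.1 = U.1 + (s * (p * n)%N%:Z + t * (q * n)%N%:Z) by rewrite -h1; ring.
  ring.
have phi_gpt (z : gen n p) (l : 'I_n) : phi (gpt z l) = (pcoord z l)%:Z * n%:Z + (z.1 l)%:Z.
  have <- : (gpoint z l).1%:Z = (pcoord z l)%:Z * n%:Z + (z.1 l)%:Z by rewrite -PoszM -PoszD.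
  by rewrite /phi gpt2 divz_nat divn_small // mul0r subr0 modz_nat modn_small ?gpoint1_lt.
have sumE z : \sum_l phi (gpt z l) = (\sum_(l < n) (pcoord z l)%:Z) * n%:Z + \sum_(l < n) l%:Z.
  rewrite mulr_suml [X in _ + X](reindex_inj (@perm_inj _ z.1)) -big_split /=.
  by apply: eq_bigr => l _.
have := sum_gpt_swp phi_inv xP xQ ne yE.
rewrite !sumE => e; have : (N%:Z %| (\sum_(l < n) (pcoord x l)%:Z - \sum_(l < n) (pcoord y l)%:Z) * n%:Z)%Z.
  rewrite (_ : _ * _ = phi P + phi Q - phi (Q.1, P.2) - phi (P.1, Q.2)); last by rewrite -e; ring.
  pose lin (T : int * int) := T.1 - (T.2 %/ n%:Z)%Z * (q * n)%N%:Z.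
  have phiE T : (N%:Z %| phi T - lin T)%Z by rewrite -rpredN opprB dvd_sub_mod subrr.
  rewrite [X in (_ %| X)%Z](_ : _ = (phi P - lin P) + (phi Q - lin Q)
    - (phi (Q.1, P.2) - lin (Q.1, P.2)) - (phi (P.1, Q.2) - lin (P.1, Q.2))).
    by do 2![apply: rpredB; last exact: phiE]; apply: rpredD; exact: phiE.
  by rewrite /lin /=; ring.
by rewrite PoszM dvdz_mul2r.
Qed.

End Gradings.

(** * Juxtapositions of two rectangles *)

Definition quad : Type := ((int * int) * (int * int) * ((int * int) * (int * int)))%type.

(* A quad (P, Q, (A, B)) stands for a rectangle with corners P and Q followed by
   one with corners A and B.  The first one creates the corners S = (Q.1, P.2) and
   W = (P.1, Q.2).  If one of A, B is a translate of S or W and the other one is an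
   untouched point, then R is the position of the latter next to the first
   rectangle, and the union of the two rectangles is an L-shape that can be cut in
   two ways.  If both A and B are translates of S and W, then the union is an
   annulus in the direction (u, v): two upright pieces placed side by side are
   exchanged with two long flat ones, spiralling around it. *)
Definition exchange (c : quad) : quad :=
  let: (P, Q, (A, B)) := c in
  if cg A.2 P.2 then
    let R := (B.1 + Q.1 - A.1, B.2 + P.2 - A.2) in
    if cg B.2 Q.2 then
      let u := R.1 - P.1 in let v := R.2 - Q.2 in
      if 0 < v then
        let i := ((Q.2 - P.2) %/ v)%Z + 1 in
        ((Q.1 - i * u, Q.2 - i * v), P, ((Q.1 - i * u, P.2), (P.1 + u, Q.2 - i * v + v)))
      else
        let j := ((Q.2 - P.2) %/ (- v))%Z in
        (P, (Q.1 + j * u, Q.2 + j * v), ((P.1, Q.2 + j * v), (Q.1 + j * u - u, P.2 - v)))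
    else if Q.2 < R.2 then (Q, R, (P, (R.1, Q.2))) else (P, R, ((P.1, R.2), Q))
  else if cg A.2 Q.2 then
    let R := (B.1 + P.1 - A.1, B.2 + Q.2 - A.2) in
    if cg B.2 P.2 then
      let u := R.1 - Q.1 in let v := R.2 - P.2 in
      if 0 < u then
        let i := ((Q.1 - P.1) %/ u)%Z + 1 in
        ((Q.1 - i * u, Q.2 - i * v), P, ((P.1, Q.2 - i * v), (Q.1 - i * u + u, P.2 + v)))
      else
        let j := ((Q.1 - P.1) %/ (- u))%Z in
        (P, (Q.1 + j * u, Q.2 + j * v), ((Q.1 + j * u, P.2), (P.1 - u, Q.2 + j * v - v)))
    else if Q.1 < R.1 then (Q, R, (P, (Q.1, R.2))) else (P, R, ((R.1, P.2), Q))
  else if cg B.2 P.2 then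
    let R := (A.1 + Q.1 - B.1, A.2 + P.2 - B.2) in
    if R.1 < P.1 then (R, P, ((P.1, R.2), Q)) else (R, Q, (P, (R.1, Q.2)))
  else if cg B.2 Q.2 then
    let R := (A.1 + P.1 - B.1, A.2 + Q.2 - B.2) in
    if R.2 < P.2 then (R, P, ((R.1, P.2), Q)) else (R, Q, (P, (Q.1, R.2)))
  else (A, B, (P, Q)).

Definition same_quad (c d : quad) : Prop :=
  same_rect c.1.1 c.1.2 d.1.1 d.1.2 /\ same_rect c.2.1 c.2.2 d.2.1 d.2.2.

Lemma same_rect_refl P Q : same_rect P Q P Q.
Proof. by split=> //; exact: eqpt_refl. Qed.

Lemma same_rect_sym P Q P' Q' : same_rect P Q P' Q' -> same_rect P' Q' P Q.
Proof. by case=> h h1 h2; split; rewrite ?h1 ?h2 // eqpt_sym. Qed.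

Lemma same_rect_trans P1 Q1 P Q P2 Q2 :
  same_rect P1 Q1 P Q -> same_rect P Q P2 Q2 -> same_rect P1 Q1 P2 Q2.
Proof.
by case=> h h1 h2 [h' h3 h4]; split; rewrite ?h1 ?h2 //; apply: eqpt_trans h'.
Qed.

Lemma same_quad_sym c d : same_quad c d -> same_quad d c.
Proof. by case=> /same_rect_sym h /same_rect_sym h'. Qed.

Lemma same_quad_trans d c e : same_quad c d -> same_quad d e -> same_quad c e.
Proof. by case=> h1 h2 [h3 h4]; split; [exact: same_rect_trans h3|exact: same_rect_trans h4]. Qed.

Lemma cg_shift a b u v : (n%:Z %| u)%Z -> (n%:Z %| v)%Z -> cg (a + u) (b + v) = cg a b.
Proof.
move=> hu hv; rewrite (@cgl (a + u) a); last by rewrite /cg addrAC subrr add0r.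
by apply: cgr; rewrite /cg addrAC subrr add0r.
Qed.

Lemma same_rectP P Q P' Q' : same_rect P Q P' Q' ->
  exists u v, [/\ L u v, P = shift P' u v & Q = shift Q' u v].
Proof.
case=> h h1 h2; exists (P.1 - P'.1), (P.2 - P'.2); split=> //.
  by rewrite /shift [LHS]surjective_pairing; congr pair; ring.
rewrite /shift [LHS]surjective_pairing; congr pair.
  by rewrite -[LHS](subrK P.1) h1; ring.
by rewrite -[LHS](subrK P.2) h2; ring.
Qed.

Lemma same_rect_shift P Q u v P' Q' : L u v ->
  P.1 = P'.1 + u -> P.2 = P'.2 + v -> Q.1 = Q'.1 + u -> Q.2 = Q'.2 + v ->
  same_rect P Q P' Q'.
Proof.
move=> h e1 e2 e3 e4; split; rewrite ?e1 ?e2 ?e3 ?e4 /=; [|ring|ring].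
by rewrite /eqpt e1 e2 ![_ + _ - _]addrAC !subrr !add0r.
Qed.

(** The tests and the position [R] depend only on differences of coordinates and congruences modulo
    [n], so translating the two rectangles, even by different lattice vectors, translates the
    rectangles of the result. Thus [exchange] is defined on the torus. *)
Lemma exchange_same c d : same_quad c d -> same_quad (exchange c) (exchange d).
Proof.
case: c d => [[P Q] [A B]] [[P' Q'] [A' B']] [/same_rectP[u [v [/= huv -> ->]]]].
move=> /same_rectP[s [t [/= hst -> ->]]]; move: P' Q' A' B' => {}P {}Q {}A {}B.
have v0 := lattice_dvd2 huv; have t0 := lattice_dvd2 hst.
rewrite /exchange /= !cg_shift //.
have fin P1 Q1 A1 B1 P2 Q2 A2 B2 :
    P1 = shift P2 u v -> Q1 = shift Q2 u v -> A1 = shift A2 u v -> B1 = shift B2 u v ->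
    same_quad (P1, Q1, (A1, B1)) (P2, Q2, (A2, B2)).
  by move=> -> -> -> ->; split; apply: (same_rect_shift huv).
have -> : Q.2 + v - (P.2 + v) = Q.2 - P.2 by ring.
have -> : Q.1 + u - (P.1 + u) = Q.1 - P.1 by ring.
have -> : B.1 + s + (Q.1 + u) - (A.1 + s) - (P.1 + u) = B.1 + Q.1 - A.1 - P.1 by ring.
have -> : B.2 + t + (P.2 + v) - (A.2 + t) - (Q.2 + v) = B.2 + P.2 - A.2 - Q.2 by ring.
have -> : B.1 + s + (P.1 + u) - (A.1 + s) - (Q.1 + u) = B.1 + P.1 - A.1 - Q.1 by ring.
have -> : B.2 + t + (Q.2 + v) - (A.2 + t) - (P.2 + v) = B.2 + Q.2 - A.2 - P.2 by ring.
have -> : (Q.2 + v < B.2 + t + (P.2 + v) - (A.2 + t)) = (Q.2 < B.2 + P.2 - A.2) by lia.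
have -> : (Q.1 + u < B.1 + s + (P.1 + u) - (A.1 + s)) = (Q.1 < B.1 + P.1 - A.1) by lia.
have -> : (A.1 + s + (Q.1 + u) - (B.1 + s) < P.1 + u) = (A.1 + Q.1 - B.1 < P.1) by lia.
have -> : (A.2 + t + (Q.2 + v) - (B.2 + t) < P.2 + v) = (A.2 + Q.2 - B.2 < P.2) by lia.
do 2![case: ifP => _]; try by case: ifP => _; apply: fin; rewrite /shift /=; congr pair; ring.
  case: ifP => _; first by case: ifP => _; apply: fin; rewrite /shift /=; congr pair; ring.
  by case: ifP => _; apply: fin; rewrite /shift /=; congr pair; ring.
case: ifP => _; first by case: ifP => _; apply: fin; rewrite /shift /=; congr pair; ring.
case: ifP => _; first by case: ifP => _; apply: fin; rewrite /shift /=; congr pair; ring.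
by split; [apply: (same_rect_shift hst)|apply: (same_rect_shift huv)].
Qed.

(** * Two decompositions of the same union *)

Record valid (s : int * int -> bool) (c : quad) : Prop := Valid {
  valid_P : s c.1.1;
  valid_Q : s c.1.2;
  valid_PQ : ~~ cg c.1.1.2 c.1.2.2;
  valid_below1 : below c.1.1 c.1.2;
  valid_A : swp s c.1.1 c.1.2 c.2.1;
  valid_B : swp s c.1.1 c.1.2 c.2.2;
  valid_AB : ~~ cg c.2.1.2 c.2.2.2;
  valid_below2 : below c.2.1 c.2.2
}.

Definition target (s : int * int -> bool) (c : quad) :=
  swp (swp s c.1.1 c.1.2) c.2.1 c.2.2.

Definition quad_area f (c : quad) := area f c.1.1 c.1.2 + area f c.2.1 c.2.2.

(** Everything is required up to translation, as it has to descend to the torus. Since the first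
    rectangles differ, the matching will have no fixed point. *)
Record partners (s : int * int -> bool) (c d : quad) : Prop := Partners {
  partners_valid1 : valid s c;
  partners_valid2 : valid s d;
  partners_target : forall T, target s c T = target s d T;
  partners_area : forall pt, quad_area (at_pt pt) c = quad_area (at_pt pt) d;
  partners_exchange1 : same_quad (exchange c) d;
  partners_exchange2 : same_quad (exchange d) c;
  partners_neq : ~ same_rect c.1.1 c.1.2 d.1.1 d.1.2
}.

Lemma partners_sym s c d : partners s c d -> partners s d c.
Proof. by case=> *; split=> // /same_rect_sym. Qed.

Lemma same_rect_eq P Q P' Q' : P.1 = P'.1 -> P.2 = P'.2 -> Q.1 = Q'.1 -> Q.2 = Q'.2 ->
  same_rect P Q P' Q'.
Proof.
by move=> h1 h2 h3 h4; apply: (same_rect_shift lattice0); rewrite ?h1 ?h2 ?h3 ?h4 addr0.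
Qed.

Ltac same_quad_tac := split; apply: same_rect_eq => /=; lia.
Ltac area_tac :=
  let pt := fresh "pt" in let g := fresh "g" in let gE := fresh "gE" in
  intro pt; destruct (boxsum_potential (at_pt pt)) as [g gE];
  rewrite /quad_area /area !gE /=; lia.

(** * L-shapes and disjoint corners *)

Section ThreePoints.
Variables (s : int * int -> bool) (P Q R : int * int).
Hypotheses (sP : s P) (sQ : s Q) (sR : s R).
Hypotheses (nPQ : ~~ cg P.2 Q.2) (nPR : ~~ cg P.2 R.2) (nQR : ~~ cg Q.2 R.2).

Let cgs := (cg_refl, negbTE nPQ, negbTE nPR, negbTE nQR,
  negbTE (etrans (congr1 negb (cg_sym Q.2 P.2)) nPQ),
  negbTE (etrans (congr1 negb (cg_sym R.2 P.2)) nPR),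
  negbTE (etrans (congr1 negb (cg_sym R.2 Q.2)) nQR)).

Ltac valid_tac := split; rewrite /below /swp /= ?cgs ?eqpt_refl //; lia.
Let target_cases (f g : int * int -> bool) :
  (forall T, cg T.2 P.2 -> f T = g T) -> (forall T, cg T.2 Q.2 -> f T = g T) ->
  (forall T, cg T.2 R.2 -> f T = g T) ->
  (forall T, cg T.2 P.2 = false -> cg T.2 Q.2 = false -> cg T.2 R.2 = false -> f T = g T) ->
  forall T, f T = g T.
Proof.
move=> fP fQ fR f0 T.
case TP: (cg T.2 P.2); first exact: fP.
case TQ: (cg T.2 Q.2); first exact: fQ.
case TR: (cg T.2 R.2); first exact: fR.
exact: f0.
Qed.

Ltac row_tac := let T := fresh "T" in let h := fresh in intros T h;
  by rewrite /target /swp /= !(cgl _ h) !cgs.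
Ltac target_tac := apply: target_cases;
  [row_tac|row_tac|row_tac
  |let T := fresh "T" in let h1 := fresh in let h2 := fresh in let h3 := fresh in
   intros T h1 h2 h3; by rewrite /target /swp /= ?h1 ?h2 ?h3].
Ltac exchange_tac := rewrite /exchange /= ?cgs; repeat (case: ifP => ?; try lia); same_quad_tac.

(** The reentrant corner of the L-shape is [Q], a point of the initial state; the cuts from it are
    vertical in the first quad and horizontal in the second. *)
Lemma partners_chain1 : below P Q -> below Q R ->
  partners s (P, Q, ((Q.1, P.2), R)) (Q, R, (P, (R.1, Q.2))).
Proof.
move=> /andP[h1 h2] /andP[h3 h4].
split; [valid_tac|valid_tac|target_tac|area_tac|exchange_tac|exchange_tac|].
by case=> /eqpt_cg2; rewrite /= (negbTE nPQ).
Qed.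

Lemma partners_chain2 : below P Q -> below Q R ->
  partners s (P, Q, ((P.1, Q.2), R)) (Q, R, (P, (Q.1, R.2))).
Proof.
move=> /andP[h1 h2] /andP[h3 h4].
split; [valid_tac|valid_tac|target_tac|area_tac|exchange_tac|exchange_tac|].
by case=> /eqpt_cg2; rewrite /= (negbTE nPQ).
Qed.

(** The reentrant corner is now [(Q.1, R.2)], a point of the final state. *)
Lemma partners_fork_ll : P.1 < Q.1 -> Q.1 < R.1 -> P.2 < R.2 -> R.2 < Q.2 ->
  partners s (P, Q, ((Q.1, P.2), R)) (P, R, ((P.1, R.2), Q)).
Proof.
move=> h1 h2 h3 h4.
split; [valid_tac|valid_tac|target_tac|area_tac|exchange_tac|exchange_tac|].
by case=> _ _ /=; lia.
Qed.

Lemma partners_fork_ur : P.1 < R.1 -> R.1 < Q.1 -> R.2 < P.2 -> P.2 < Q.2 ->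
  partners s (P, Q, (R, (Q.1, P.2))) (R, Q, (P, (R.1, Q.2))).
Proof.
move=> h1 h2 h3 h4.
split; [valid_tac|valid_tac|target_tac|area_tac|exchange_tac|exchange_tac|].
by case=> /eqpt_cg2; rewrite /= (negbTE nPR).
Qed.

End ThreePoints.

Section FourPoints.
Variables (s : int * int -> bool) (P Q A B : int * int).

Lemma partners_disjoint : s P -> s Q -> s A -> s B ->
  ~~ cg P.2 Q.2 -> ~~ cg P.2 A.2 -> ~~ cg P.2 B.2 ->
  ~~ cg Q.2 A.2 -> ~~ cg Q.2 B.2 -> ~~ cg A.2 B.2 -> below P Q -> below A B ->
  partners s (P, Q, (A, B)) (A, B, (P, Q)).
Proof.
move=> sP sQ sA sB nPQ nPA nPB nQA nQB nAB lPQ lAB.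
have nAP : ~~ cg A.2 P.2 by rewrite cg_sym.
have nBP : ~~ cg B.2 P.2 by rewrite cg_sym.
have nAQ : ~~ cg A.2 Q.2 by rewrite cg_sym.
have nBQ : ~~ cg B.2 Q.2 by rewrite cg_sym.
split.
- by split; rewrite //= /swp ?(negbTE nAP) ?(negbTE nAQ) ?(negbTE nBP) ?(negbTE nBQ).
- by split; rewrite //= /swp ?(negbTE nPA) ?(negbTE nQA) ?(negbTE nPB) ?(negbTE nQB).
- move=> T; rewrite /target /swp /=.
  case TP: (cg T.2 P.2); first by rewrite !(cgl _ TP) (negbTE nPA) (negbTE nPB).
  case TQ: (cg T.2 Q.2); first by rewrite !(cgl _ TQ) (negbTE nQA) (negbTE nQB).
  done.
- by move=> pt; rewrite /quad_area addrC.
- rewrite /exchange (negbTE nAP) (negbTE nAQ) (negbTE nBP) (negbTE nBQ).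
  by split; apply: same_rect_refl.
- rewrite /exchange (negbTE nPA) (negbTE nPB) (negbTE nQA) (negbTE nQB).
  by split; apply: same_rect_refl.
by case=> /eqpt_cg2; rewrite /= (negbTE nPA).
Qed.

End FourPoints.

(** * Transverse annuli *)

Lemma divz_unique a d k : 0 <= a - k * d < d -> (a %/ d)%Z = k.
Proof.
move=> h; have d0 : d != 0 by lia.
have aE : a = k * d + (a - k * d) by ring.
by rewrite aE divzMDl // divz_small ?addr0 //; lia.
Qed.

Lemma lattice_mul u v k : L u v -> L (k * u) (k * v).
Proof.
case/in_latticeP=> a [b [-> ->]]; apply/in_latticeP.
by exists (k * a), (k * b); split; ring.
Qed.

Lemma eqpt_lattice a b T U : L a b -> T.1 = U.1 + a -> T.2 = U.2 + b -> eqpt T U.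
Proof. by move=> h h1 h2; rewrite /eqpt h1 h2 ![_ + _ - _]addrAC !subrr !add0r. Qed.

Lemma eqpt_latticer a b T U V : L a b -> U.1 = V.1 + a -> U.2 = V.2 + b ->
  eqpt T U = eqpt T V.
Proof.
by move=> h h1 h2; rewrite ![eqpt T _]eqpt_sym; apply: eqptl; apply: eqpt_lattice h h1 h2.
Qed.

(* The boundary of the annulus has one reentrant corner on each side; i and j are
   the numbers of turns made by the horizontal cuts starting there. *)
Section Spiral.
Variables (s : int * int -> bool) (P Q : int * int) (u v : int).
Hypotheses (hs : is_state s) (sP : s P) (sQ : s Q) (nPQ : ~~ cg P.2 Q.2).
Hypotheses (luv : L u v) (PQ : below P Q).
Hypotheses (u_big : Q.1 - P.1 < u) (v_big : P.2 - Q.2 < v).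

Let nQP : ~~ cg Q.2 P.2. Proof. by rewrite cg_sym. Qed.

Lemma cg_mul k a b : cg (a + k * v) b = cg a b.
Proof.
by rewrite -[b in LHS]addr0 cg_shift //; exact: lattice_dvd2 (lattice_mul k luv).
Qed.

Lemma cg_step a b : cg (a + v) b = cg a b.
Proof. by have := cg_mul 1 a b; rewrite mul1r. Qed.

Lemma spiral_valid : valid s (P, Q, ((Q.1, P.2), (P.1 + u, Q.2 + v))).
Proof.
case/andP: PQ => h1 h2; split; rewrite //= /swp /= ?cg_refl ?eqpt_refl //.
- rewrite !cg_step (negbTE nQP) cg_refl.
  exact: eqpt_lattice luv _ _.
- by rewrite cg_sym cg_step.
- by rewrite /below /=; apply/andP; split; lia.
Qed.

(** With oriented boxes [E k] makes sense for every integer [k], and consecutive values differ by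
    pieces translated by [(u, v)]. At [k = 0] the first box is the initial one with both pairs of
    bounds reversed, which preserves its sum. *)
Lemma spiral_area_up pt i :
  quad_area (at_pt pt) (P, Q, ((Q.1, P.2), (P.1 + u, Q.2 + v))) =
  quad_area (at_pt pt) ((Q.1 - i * u, Q.2 - i * v), P,
     ((Q.1 - i * u, P.2), (P.1 + u, Q.2 - i * v + v))).
Proof.
have [g gE] := boxsum_potential (at_pt pt).
pose E k := boxsum (at_pt pt) (Q.1 - k * u) P.1 (Q.2 - k * v) P.2
  + boxsum (at_pt pt) (Q.1 - k * u) (P.1 + u) P.2 (Q.2 - k * v + v).
have sh x1 x2 y1 y2 : boxsum (at_pt pt) (x1 + u) (x2 + u) (y1 + v) (y2 + v)
    = boxsum (at_pt pt) x1 x2 y1 y2.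
  by apply: boxsum_shift => a b; exact: at_pt_shift.
have EE : E i = E 0.
  apply: (@int_step_const _ E) => k; rewrite /E.
  have -> : Q.1 - (k + 1) * u = Q.1 - k * u - u by ring.
  have -> : Q.2 - (k + 1) * v = Q.2 - k * v - v by ring.
  move: (Q.1 - k * u) (Q.2 - k * v) => W H.
  have := sh (W - u) P.1 (H - v) P.2; have := sh (W - u) P.1 P.2 H.
  by rewrite !subrK !gE; lia.
rewrite /quad_area /area /= -/(E i) EE /E !mul0r !subr0 !gE; lia.
Qed.

Lemma spiral_area_down pt j :
  quad_area (at_pt pt) (P, Q, ((Q.1, P.2), (P.1 + u, Q.2 + v))) =
  quad_area (at_pt pt) (P, (Q.1 + j * u, Q.2 + j * v),
     ((P.1, Q.2 + j * v), (Q.1 + j * u - u, P.2 - v))).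
Proof.
have [g gE] := boxsum_potential (at_pt pt).
pose E k := boxsum (at_pt pt) P.1 (Q.1 + k * u) P.2 (Q.2 + k * v)
  + boxsum (at_pt pt) P.1 (Q.1 + k * u - u) (Q.2 + k * v) (P.2 - v).
have sh x1 x2 y1 y2 : boxsum (at_pt pt) (x1 + u) (x2 + u) (y1 + v) (y2 + v)
    = boxsum (at_pt pt) x1 x2 y1 y2.
  by apply: boxsum_shift => a b; exact: at_pt_shift.
have EE : E j = E 0.
  apply: (@int_step_const _ E) => k; rewrite /E.
  have -> : Q.1 + (k + 1) * u = Q.1 + k * u + u by ring.
  have -> : Q.2 + (k + 1) * v = Q.2 + k * v + v by ring.
  move: (Q.1 + k * u) (Q.2 + k * v) => W H.
  have := sh (W - u) W H (P.2 - v).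
  by rewrite !subrK addrK !gE; lia.
(* Translated by [(u, v)], the second box at [k = 0] becomes the second upright rectangle with both
   pairs of bounds reversed. *)
have := sh P.1 (Q.1 - u) Q.2 (P.2 - v).
rewrite /quad_area /area /= -/(E j) EE /E !mul0r !addr0 !subrK !gE; lia.
Qed.

(** [i] is the least number of steps $-(u,v)$ that bring [Q] below [P]; [exchange] finds it as a
    quotient plus 1, from heights in one direction and from widths in the other. *)
Lemma partners_spiral_up i : 0 < v -> 0 < i * v - (Q.2 - P.2) < v ->
  partners s (P, Q, ((Q.1, P.2), (P.1 + u, Q.2 + v)))
    ((Q.1 - i * u, Q.2 - i * v), P, ((Q.1 - i * u, P.2), (P.1 + u, Q.2 - i * v + v))).
Proof.
move=> v0 hi; case/andP: (PQ) => h1 h2.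
have i1 : 0 < i by nia.
have iu : u <= i * u by nia.
have cgi b : cg (Q.2 - i * v) b = cg Q.2 b by rewrite -mulNr cg_mul.
have cgi' b : cg b (Q.2 - i * v) = cg b Q.2 by rewrite cg_sym cgi cg_sym.
have cgv b : cg b (Q.2 - i * v + v) = cg b Q.2 by rewrite cg_sym cg_step cgi cg_sym.
have cgv' b : cg b (Q.2 + v) = cg b Q.2 by rewrite cg_sym cg_step cg_sym.
split.
- exact: spiral_valid.
- split; rewrite //= /swp /= ?cg_step ?cgi ?cgi' ?cgv ?cg_refl ?(negbTE nPQ) ?(negbTE nQP) ?eqpt_refl //.
  + rewrite (st_inv hs (U := Q)) //; apply: (eqpt_lattice (lattice_mul (- i) luv)) => /=; ring.
  + by rewrite /below /=; apply/andP; split; lia.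
  + by apply: (eqpt_lattice luv).
  + by rewrite /below /=; apply/andP; split; lia.
- move=> T; rewrite /target /swp /= cgv cgv' cgi'.
  case TP: (cg T.2 P.2) => //; case TQ: (cg T.2 Q.2) => //.
  apply: (eqpt_latticer _ (lattice_mul i luv)) => /=; ring.
- by move=> pt; exact: spiral_area_up.
- rewrite /exchange /= cg_refl cg_step cg_refl.
  have -> : P.1 + u + Q.1 - Q.1 - P.1 = u by ring.
  have -> : Q.2 + v + P.2 - P.2 - Q.2 = v by ring.
  rewrite v0 (@divz_unique _ _ (i - 1)); last by lia.
  by rewrite subrK; split; exact: same_rect_refl.
- rewrite /exchange /= cgi' (negbTE nPQ) cg_refl cg_step cgi cgi' cg_refl.
  have -> : P.1 + u + (Q.1 - i * u) - (Q.1 - i * u) - P.1 = u by ring.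
  have -> : Q.2 - i * v + v + P.2 - P.2 - (Q.2 - i * v) = v by ring.
  have -> : (0 < u) = true by lia.
  rewrite (@divz_unique _ _ (i - 1)); last by lia.
  by split; apply: (same_rect_shift (lattice_mul (- i) luv)) => /=; ring.
by case=> /eqpt_cg2; rewrite /= cgi' (negbTE nPQ).
Qed.

(** [j] is the largest number of steps $(u,v)$, now descending, that keep [Q] above [P]. The first
    rectangles share the corner [P] and differ by their widths. *)
Lemma partners_spiral_down j : v < 0 -> 0 < Q.2 - P.2 + j * v < - v ->
  partners s (P, Q, ((Q.1, P.2), (P.1 + u, Q.2 + v)))
    (P, (Q.1 + j * u, Q.2 + j * v), ((P.1, Q.2 + j * v), (Q.1 + j * u - u, P.2 - v))).
Proof.
move=> v0 hj; case/andP: (PQ) => h1 h2.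
have j1 : 0 < j by nia.
have ju : u <= j * u by nia.
have cgj b : cg (Q.2 + j * v) b = cg Q.2 b by rewrite cg_mul.
have cgj' b : cg b (Q.2 + j * v) = cg b Q.2 by rewrite cg_sym cgj cg_sym.
have cgv b : cg (P.2 - v) b = cg P.2 b by rewrite -mulN1r cg_mul.
have cgv' b : cg b (P.2 - v) = cg b P.2 by rewrite cg_sym cgv cg_sym.
have cgw b : cg b (Q.2 + v) = cg b Q.2 by rewrite cg_sym cg_step cg_sym.
split.
- exact: spiral_valid.
- split; rewrite //= /swp /= ?cgv ?cgj ?cgj' ?cgv' ?cg_refl ?(negbTE nPQ) ?(negbTE nQP) ?eqpt_refl //.
  + rewrite (st_inv hs (U := Q)) //; apply: (eqpt_lattice (lattice_mul j luv)) => /=; ring.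
  + by rewrite /below /=; apply/andP; split; lia.
  + by apply: (eqpt_lattice (lattice_mul (-1) luv)) => /=; ring.
  + by rewrite /below /=; apply/andP; split; lia.
- move=> T; rewrite /target /swp /= cgw cgv' cgj'.
  case TP: (cg T.2 P.2); case TQ: (cg T.2 Q.2) => //.
  + by move: nPQ; rewrite -(cgl _ TP) TQ.
  + apply: (eqpt_latticer _ luv) => /=; ring.
  + apply: (eqpt_latticer _ (lattice_mul (1 - j) luv)) => /=; ring.
- by move=> pt; exact: spiral_area_down.
- rewrite /exchange /= cg_refl cg_step cg_refl.
  have -> : P.1 + u + Q.1 - Q.1 - P.1 = u by ring.
  have -> : Q.2 + v + P.2 - P.2 - Q.2 = v by ring.
  have -> : (0 < v) = false by lia.
  rewrite (@divz_unique _ _ j); last by lia.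
  by split; exact: same_rect_refl.
- rewrite /exchange /= cgj (negbTE nQP) cgj' cgj cg_refl cgv cg_refl.
  have -> : Q.1 + j * u - u + P.1 - P.1 - (Q.1 + j * u) = - u by ring.
  have -> : P.2 - v + (Q.2 + j * v) - (Q.2 + j * v) - P.2 = - v by ring.
  have -> : (0 < - u) = false by lia.
  rewrite opprK (@divz_unique _ _ j); last by lia.
  by split; apply: same_rect_eq => /=; ring.
by case=> _ /= h _; nia.
Qed.

End Spiral.

(* The union contains a closed row or column of squares, hence an X marking. *)
Definition annular (c : quad) : bool :=
  let: (P, Q, (A, B)) := c in
  [&& cg A.2 P.2, cg B.2 Q.2 & B.2 - A.2 == Q.2 - P.2] ||
  [&& cg A.2 Q.2, cg B.2 P.2 & B.1 - A.1 == Q.1 - P.1].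

Lemma swp_shift s P Q u v T : L u v -> swp s (shift P u v) (shift Q u v) T = swp s P Q T.
Proof.
move=> h; have v0 := lattice_dvd2 h.
have cgE a : cg T.2 (a + v) = cg T.2 a by rewrite cg_sym -[T.2 in LHS]addr0 cg_shift // cg_sym.
have e a b : eqpt T (a + u, b + v) = eqpt T (a, b).
  by rewrite ![eqpt T _]eqpt_sym -(eqpt_shift (a, b) T h).
by rewrite /swp /= !cgE !e.
Qed.

(** * Existence of the other decomposition *)

Lemma multiple_between (a u : int) : 0 < u -> ~~ (u %| a)%Z ->
  exists k, 0 < a - k * u < u.
Proof.
move=> u0 na; exists (a %/ u)%Z.
have rE : a - (a %/ u)%Z * u = (a %% u)%Z by rewrite {1}(divz_eq a u) addrAC subrr add0r.
have r_lt := ltz_pmod a u0; have r_ge0 := modz_ge0 a (lt0r_neq0 u0).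
have r_neq0 : (a %% u)%Z != 0 by apply: contra na => /eqP/dvdz_mod0P.
by rewrite rE lt0r r_neq0 r_ge0.
Qed.

Lemma st_col_neq s P Q : is_state s -> s P -> s Q -> ~~ cg P.2 Q.2 -> ~~ cg P.1 Q.1.
Proof. by move=> hs sP sQ; apply: contra => /(st_col hs sP sQ)/eqpt_cg2. Qed.

Lemma exists_spiral_partner s P Q u v : is_state s -> s P -> s Q -> ~~ cg P.2 Q.2 ->
  L u v -> below P Q -> Q.1 - P.1 < u -> P.2 - Q.2 < v -> v != 0 ->
  exists d, partners s (P, Q, ((Q.1, P.2), (P.1 + u, Q.2 + v))) d.
Proof.
move=> hs sP sQ nPQ luv lPQ u_big v_big v_neq0.
(* [n] divides [v] while [P] and [Q] are in different rows, so no number of turns brings [Q] exactly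
   to the height of [P]. *)
have nv : ~~ (v %| Q.2 - P.2)%Z.
  by apply: contra nPQ; rewrite cg_sym; apply: dvdz_trans; exact: lattice_dvd2 luv.
case: (ltrgt0P v) v_neq0 => // v0 _.
  have [k hk] := multiple_between v0 nv.
  eexists; apply: (partners_spiral_up hs sP sQ nPQ luv lPQ u_big v_big (i := k + 1) v0).
  by move: hk; rewrite mulrDl mul1r; move: (k * v) => kv; clear; lia.
have v0' : 0 < - v by rewrite oppr_gt0.
have [|k hk] := @multiple_between (Q.2 - P.2) (- v) v0'.
  by rewrite dvdzE abszN -dvdzE.
eexists; apply: (partners_spiral_down hs sP sQ nPQ luv lPQ u_big v_big (j := k) v0).
by move: hk; rewrite mulrN opprK.
Qed.

(** The given pair, stacked vertically, is the spiralling member of a pair of partners already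
    constructed. Unwinding it amounts to finding the corner [Q'] of the upright member; the symmetry
    of [partners] concludes. *)
Lemma exists_spiral_partner' s P Q u v : is_state s -> s P -> s Q -> ~~ cg P.2 Q.2 ->
  L u v -> below P Q -> P.1 - Q.1 < u -> Q.2 - P.2 < v -> u != 0 ->
  exists d, partners s (P, Q, ((P.1, Q.2), (Q.1 + u, P.2 + v))) d.
Proof.
move=> hs sP sQ nPQ luv /andP[lPQ1 lPQ2] u_big v_big u_neq0.
have nu : ~~ (u %| Q.1 - P.1)%Z.
  apply: contra (st_col_neq hs sP sQ nPQ); rewrite cg_sym; apply: dvdz_trans.
  exact: lattice_dvd1 luv.
have v0 : 0 < v by lia.
have eqQ a b : L a b -> forall T : int * int, eqpt (T.1 + a, T.2 + b) T.
  by move=> h T; apply: (eqpt_lattice h).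
case: (ltrgt0P u) u_neq0 => // u0 _.
  have [k hk] := multiple_between u0 nu.
  have k0 : 0 <= k by move: hk lPQ1 u0; clear; nia.
  have kv0 : 0 <= k * v by rewrite mulr_ge0 // ltW.
  (* The first translate of [P] along [(u, v)] to the right of [Q]. *)
  pose Q' := (P.1 + (k + 1) * u, P.2 + (k + 1) * v).
  have e : eqpt Q' P := eqQ _ _ (lattice_mul (k + 1) luv) P.
  have nQ : ~~ cg Q.2 Q'.2 by rewrite (cgr _ (eqpt_cg2 e)) cg_sym.
  have sQ' : s Q' by rewrite (st_inv hs e).
  have := @partners_spiral_up s Q Q' u v hs sQ sQ' nQ luv _ _ _ (k + 1).
  rewrite /Q' /=.
  have -> : P.1 + (k + 1) * u - (k + 1) * u = P.1 by ring.
  have -> : P.2 + (k + 1) * v - (k + 1) * v = P.2 by ring.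
  rewrite -!surjective_pairing => h; eexists; apply: partners_sym.
  apply: h; move: hk kv0; rewrite /below /= ?mulrDl ?mul1r.
  1-5: move: (k * u) (k * v) lPQ1 lPQ2 u_big v_big v0; clear; lia.
have u0' : 0 < - u by rewrite oppr_gt0.
have [|k hk] := @multiple_between (Q.1 - P.1) (- u) u0'.
  by rewrite dvdzE abszN -dvdzE.
have k1 : 1 <= k by move: hk u_big u0; clear; nia.
have kv0 : v <= k * v by rewrite ler_peMl // ltW.
(* The last translate of [Q] along [(u, v)] still to the right of [P]. *)
pose Q' := (Q.1 + k * u, Q.2 + k * v).
have e : eqpt Q' Q := eqQ _ _ (lattice_mul k luv) Q.
have nQ : ~~ cg P.2 Q'.2 by rewrite (cgr _ (eqpt_cg2 e)).
have sQ' : s Q' by rewrite (st_inv hs e).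
have := @partners_spiral_down s P Q' (- u) (- v) hs sP sQ' nQ (latticeN luv) _ _ _ k.
rewrite /Q' /=.
have -> : Q.1 + k * u + k * - u = Q.1 by ring.
have -> : Q.2 + k * v + k * - v = Q.2 by ring.
rewrite !opprK -!surjective_pairing => h; eexists; apply: partners_sym; apply: h.
all: move: hk kv0; rewrite /below /= ?mulrN.
all: move: (k * u) (k * v) lPQ1 lPQ2 u_big v_big v0; clear; lia.
Qed.

(** [lower] and [upper] translate the second rectangle so that a corner coincides with one created
    by the first. When only one corner is shared, the free one has eight positions, covered by the
    four L-shape lemmas read in both directions; ties between coordinates are excluded, as distinct
    orbits of a state have distinct rows and columns. *)
Lemma exists_partner s c : is_state s -> valid s c -> ~~ annular c ->
  exists c0 d, [/\ c0.1 = c.1, same_rect c.2.1 c.2.2 c0.2.1 c0.2.2 & partners s c0 d].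
Proof.
case: c => [[P Q] [A B]] hs [/= sP sQ nPQ lPQ sA sB nAB lAB].
have nQP : ~~ cg Q.2 P.2 by rewrite cg_sym.
have neq1 T U : s T -> s U -> ~~ cg T.2 U.2 -> T.1 != U.1.
  move=> sT sU nTU; apply: contra (st_col_neq hs sT sU nTU) => /eqP ->; exact: cg_refl.
have neq2 (T U : int * int) : ~~ cg T.2 U.2 -> T.2 != U.2.
  by apply: contra => /eqP ->; exact: cg_refl.
have lower X Y : eqpt (X, Y) A ->
    let R := (B.1 + (X - A.1), B.2 + (Y - A.2)) in
    [/\ same_rect A B (X, Y) R, eqpt R B, forall b, cg R.2 b = cg B.2 b,
        X < R.1 & Y < R.2].
  move=> e R; have BR : eqpt R B by rewrite /eqpt /= ![_ + (_ - _) - _]addrAC !subrr !add0r.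
  move: lAB => /andP[lt1 lt2].
  split=> //=; last 2 first.
  - by move: lt1; clear; lia.
  - by move: lt2; clear; lia.
  - by split; rewrite /R /=; [rewrite eqpt_sym|ring|ring].
  by move=> b; apply: cgl; exact: eqpt_cg2 BR.
have upper X Y : eqpt (X, Y) B ->
    let R := (A.1 + (X - B.1), A.2 + (Y - B.2)) in
    [/\ same_rect A B R (X, Y), eqpt R A, forall b, cg R.2 b = cg A.2 b,
        R.1 < X & R.2 < Y].
  move=> e R; have BR : eqpt R A by rewrite /eqpt /= ![_ + (_ - _) - _]addrAC !subrr !add0r.
  move: lAB => /andP[lt1 lt2].
  split=> //=; last 2 first.
  - by move: lt1; clear; lia.
  - by move: lt2; clear; lia.
  - by split; rewrite /R /=; [rewrite eqpt_sym|ring|ring].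
  by move=> b; apply: cgl; exact: eqpt_cg2 BR.
case/andP: (lPQ) => lPQ1 lPQ2.
rewrite /annular; case: (boolP (cg A.2 P.2)) => [AP|nAP] /=.
  have nBP : ~~ cg B.2 P.2 by rewrite -(cgr _ AP) cg_sym.
  have nAQ : ~~ cg A.2 Q.2 by rewrite (cgl _ AP).
  rewrite (negbTE nAQ) /= orbF => ann.
  have /lower[] : eqpt (Q.1, P.2) A by move: sA; rewrite /swp AP eqpt_sym.
  set R := (_ + (_ - _), _) => same RB cgR lt1 lt2.
  exists (P, Q, ((Q.1, P.2), R)).
  case: (boolP (cg B.2 Q.2)) ann => [BQ|nBQ] /= ann.
    have luv : L (R.1 - P.1) (R.2 - Q.2).
      by move: sB; rewrite /swp (negbTE nBP) BQ => /(eqpt_trans RB).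
    have [|||d pd] := exists_spiral_partner hs sP sQ nPQ luv lPQ.
    - by rewrite ltrD2r.
    - by rewrite ltrD2r.
    - by move: ann; rewrite /R /=; clear; lia.
    by exists d; rewrite ![_ + (_ - _)]addrC !subrK -surjective_pairing in pd.
  have sR : s R.
    by rewrite (st_inv hs RB); move: sB; rewrite /swp (negbTE nBP) (negbTE nBQ).
  have nPR : ~~ cg P.2 R.2 by rewrite cg_sym cgR.
  have nQR : ~~ cg Q.2 R.2 by rewrite cg_sym cgR.
  case: (ltgtP Q.2 R.2) (neq2 _ _ nQR) => // h _.
    by eexists; split=> //; apply: partners_chain1 => //; apply/andP.
  by eexists; split=> //; apply: partners_fork_ll.
case: (boolP (cg A.2 Q.2)) => [AQ|nAQ] /=.
  have nBQ : ~~ cg B.2 Q.2 by rewrite -(cgr _ AQ) cg_sym.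
  move=> ann.
  have /lower[] : eqpt (P.1, Q.2) A by move: sA; rewrite /swp (negbTE nAP) AQ eqpt_sym.
  set R := (_ + (_ - _), _) => same RB cgR lt1 lt2.
  exists (P, Q, ((P.1, Q.2), R)).
  case: (boolP (cg B.2 P.2)) ann => [BP|nBP] /= ann.
    have luv : L (R.1 - Q.1) (R.2 - P.2).
      by move: sB; rewrite /swp BP => /(eqpt_trans RB).
    have [|||d pd] := exists_spiral_partner' hs sP sQ nPQ luv lPQ.
    - by rewrite ltrD2r.
    - by rewrite ltrD2r.
    - by move: ann; rewrite /R /=; clear; lia.
    by exists d; rewrite ![_ + (_ - _)]addrC !subrK -surjective_pairing in pd.
  have sR : s R.
    by rewrite (st_inv hs RB); move: sB; rewrite /swp (negbTE nBP) (negbTE nBQ).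
  have nPR : ~~ cg P.2 R.2 by rewrite cg_sym cgR.
  have nQR : ~~ cg Q.2 R.2 by rewrite cg_sym cgR.
  case: (ltgtP Q.1 R.1) (neq1 _ _ sQ sR nQR) => // h _.
    by eexists; split=> //; apply: partners_chain2 => //; apply/andP.
  eexists; split=> //; apply: partners_sym; apply: partners_fork_ll => //.
  by rewrite cgR.
move=> _.
have sA' : s A by move: sA; rewrite /swp (negbTE nAP) (negbTE nAQ).
case: (boolP (cg B.2 P.2)) => [BP|nBP].
  have /upper[] : eqpt (Q.1, P.2) B by move: sB; rewrite /swp BP eqpt_sym.
  set R := (_ + (_ - _), _) => same RA cgR lt1 lt2.
  have sR : s R by rewrite (st_inv hs RA).
  have nRP : ~~ cg R.2 P.2 by rewrite cgR.
  have nRQ : ~~ cg R.2 Q.2 by rewrite cgR.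
  exists (P, Q, (R, (Q.1, P.2))).
  case: (ltgtP R.1 P.1) (neq1 _ _ sR sP nRP) => // h _.
    eexists; split=> //; apply: partners_sym; apply: partners_chain1 => //.
    by apply/andP.
  by eexists; split=> //; apply: partners_fork_ur => //; rewrite cg_sym.
case: (boolP (cg B.2 Q.2)) => [BQ|nBQ].
  have /upper[] : eqpt (P.1, Q.2) B by move: sB; rewrite /swp (negbTE nBP) BQ eqpt_sym.
  set R := (_ + (_ - _), _) => same RA cgR lt1 lt2.
  have sR : s R by rewrite (st_inv hs RA).
  have nRP : ~~ cg R.2 P.2 by rewrite cgR.
  have nRQ : ~~ cg R.2 Q.2 by rewrite cgR.
  exists (P, Q, (R, (P.1, Q.2))).
  case: (ltgtP R.2 P.2) (neq2 _ _ nRP) => // h _.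
    eexists; split=> //; apply: partners_sym; apply: partners_chain2 => //.
    by apply/andP.
  by eexists; split=> //; apply: partners_sym; apply: partners_fork_ur.
have sB' : s B by move: sB; rewrite /swp (negbTE nBP) (negbTE nBQ).
exists (P, Q, (A, B)); eexists; split=> //; first exact: same_rect_refl.
by apply: partners_disjoint => //; rewrite cg_sym.
Qed.

Record switched s c d : Prop := Switched {
  switched_valid : valid s d;
  switched_target : forall T, target s d T = target s c T;
  switched_area : forall pt, quad_area (at_pt pt) d = quad_area (at_pt pt) c;
  switched_exchange : same_quad (exchange c) d;
  switched_exchangeK : same_quad (exchange d) c;
  switched_neq : ~ same_quad c d
}.

Lemma exists_switched s c : is_state s -> valid s c -> ~~ annular c ->
  exists d, switched s c d.
Proof.
move=> hs hc /(exists_partner hs hc)[c0 [d [e1 same [_ vd tgt ar psi1 psi2 neq]]]].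
have cc0 : same_quad c c0 by split=> //; rewrite e1; exact: same_rect_refl.
have [a [b [hab eA eB]]] := same_rectP same.
exists d; split=> //.
- move=> T; rewrite -tgt /target e1 eA eB.
  by rewrite swp_shift.
- move=> pt; rewrite -ar /quad_area e1 eA eB.
  by rewrite area_shift.
- exact: same_quad_trans (exchange_same cc0) psi1.
- exact: same_quad_trans psi2 (same_quad_sym cc0).
by case=> h _; apply: neq; rewrite e1.
Qed.

(** * The differential *)

Definition quad_of (r1 r2 : rect n p) : quad :=
  (corner_ll r1, corner_ur r1, (corner_ll r2, corner_ur r2)).

Definition mkrects (c : quad) : rect n p * rect n p :=
  (mkrect c.1.1 c.1.2, mkrect c.2.1 c.2.2).

Definition small_quad (c : quad) := small_rect c.1.1 c.1.2 && small_rect c.2.1 c.2.2.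

Lemma small_rect_corners r : below (corner_ll r) (corner_ur r) ->
  small_rect (corner_ll r) (corner_ur r).
Proof.
case/andP; rewrite /= !ltrDl => h1 h2.
rewrite /small_rect /= (addrC (ra r)%:Z) (addrC (rb r)%:Z) !addrK h1 h2 /=.
by rewrite !ltz_nat !ltn_ord.
Qed.

Lemma small_rect_same P Q P' Q' : same_rect P Q P' Q' ->
  small_rect P Q = small_rect P' Q'.
Proof. by case=> _ h1 h2; rewrite /small_rect h1 h2. Qed.

Lemma small_quad_same c d : same_quad c d -> small_quad c = small_quad d.
Proof. by case=> h1 h2; rewrite /small_quad (small_rect_same h1) (small_rect_same h2). Qed.

Lemma quad_of_mkrects c : small_quad c -> same_quad (quad_of (mkrects c).1 (mkrects c).2) c.
Proof. by case/andP=> h1 h2; split; apply: mkrectE. Qed.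

Lemma quad_of_inj r1 r2 r1' r2' :
  same_quad (quad_of r1 r2) (quad_of r1' r2') -> (r1, r2) = (r1', r2').
Proof. by case=> /= /rect_eq -> /rect_eq ->. Qed.

Lemma swp_same s P Q P' Q' T : same_rect P Q P' Q' -> swp s P Q T = swp s P' Q' T.
Proof. by move=> /same_rectP[u [v [h -> ->]]]; apply: swp_shift. Qed.

Lemma swp_ext s s' P Q T : (forall U, s U = s' U) -> swp s P Q T = swp s' P Q T.
Proof. by move=> h; rewrite /swp h. Qed.

Lemma target_same s c d T : same_quad c d -> target s c T = target s d T.
Proof.
case=> h1 h2; rewrite /target (swp_same _ _ h2); apply: swp_ext => U.
exact: swp_same.
Qed.

Lemma quad_area_same pt c d : same_quad c d -> quad_area (at_pt pt) c = quad_area (at_pt pt) d.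
Proof.
case: c d => [[P Q] [A B]] [[P' Q'] [A' B']] [/= h1 h2].
have [u [v [huv -> ->]]] := same_rectP h1; have [u' [v' [huv' -> ->]]] := same_rectP h2.
by rewrite /quad_area /= !area_shift.
Qed.

Lemma below_same P Q P' Q' : same_rect P Q P' Q' -> below P Q = below P' Q'.
Proof.
case=> _ h1 h2; rewrite /below -(subr_gt0 P.1) -(subr_gt0 P.2) h1 h2.
by rewrite !subr_gt0.
Qed.

Lemma same_rect_eqpt P Q P' Q' : same_rect P Q P' Q' -> eqpt P P' /\ eqpt Q Q'.
Proof.
move=> /same_rectP[u [v [h -> ->]]]; split.
  exact: (@eqpt_lattice u v).
exact: (@eqpt_lattice u v).
Qed.

Lemma valid_same s c d : is_state s -> same_quad c d -> valid s c -> valid s d.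
Proof.
move=> hs cd [sP sQ nPQ lPQ sA sB nAB lAB].
have hs' : is_state (swp s c.1.1 c.1.2) by apply: swp_state.
case: (cd) => h1 h2.
have [eP eQ] := same_rect_eqpt h1; have [eA eB] := same_rect_eqpt h2.
split.
- by rewrite -(st_inv hs eP).
- by rewrite -(st_inv hs eQ).
- by rewrite -(cgl _ (eqpt_cg2 eP)) -(cgr _ (eqpt_cg2 eQ)).
- by rewrite -(below_same h1).
- by rewrite -(swp_same _ _ h1) -(st_inv hs' eA).
- by rewrite -(swp_same _ _ h1) -(st_inv hs' eB).
- by rewrite -(cgl _ (eqpt_cg2 eA)) -(cgr _ (eqpt_cg2 eB)).
- by rewrite -(below_same h2).
Qed.

Lemma Rect_valid (x y z : gen n p) (r1 r2 : rect n p) : Rect q x y r1 -> Rect q y z r2 ->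
  valid (on x) (quad_of r1 r2) /\ (forall T, on z T = target (on x) (quad_of r1 r2) T).
Proof.
move=> /RectP[h1 h2 h3 h4 yE] /RectP[k1 k2 k3 k4 zE]; split.
  by split; rewrite //= -?yE.
by move=> T; rewrite zE; apply: swp_ext.
Qed.

Lemma valid_Rect (x z : gen n p) (r1 r2 : rect n p) : valid (on x) (quad_of r1 r2) ->
  (forall T, on z T = target (on x) (quad_of r1 r2) T) ->
  exists y, Rect q x y r1 /\ Rect q y z r2.
Proof.
move=> [/= sP sQ nPQ lPQ sA sB nAB lAB] zE.
have [y yE] := realize (swp_state (on_state x) sP sQ nPQ).
exists y; split; apply/RectP; split=> //; rewrite ?yE //.
by move=> T; rewrite zE; apply: swp_ext => U; rewrite yE.
Qed.

Lemma Rect_uniq (x y y' : gen n p) (r : rect n p) : Rect q x y r -> Rect q x y' r -> y = y'.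
Proof.
by move=> /RectP[_ _ _ _ yE] /RectP[_ _ _ _ yE']; apply: on_inj => T; rewrite yE yE'.
Qed.

(** The value is unique by [Rect_uniq]; the default [x] is returned only if [r] leads from [x] to no
    generator. *)
Definition rect_target (x : gen n p) (r : rect n p) : gen n p :=
  odflt x [pick y | Rect q x y r].

Lemma rect_targetE (x y : gen n p) (r : rect n p) : Rect q x y r -> rect_target x r = y.
Proof.
move=> h; rewrite /rect_target; case: pickP => [y' /Rect_uniq/(_ h)//|/(_ y)].
by rewrite h.
Qed.

Lemma at_pt_ge0 pt i j : 0 <= at_pt pt i j. Proof. exact: ler0n. Qed.

Lemma area_ge0 pt P Q : below P Q -> 0 <= area (at_pt pt) P Q.
Proof. by case/andP=> h1 h2; apply: (boxsumP (at_pt_ge0 pt) (ltW h1) (ltW h2)).1. Qed.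

Lemma area_gt0 pt P Q i j : eqpt (i, j) pt -> P.1 <= i < Q.1 -> P.2 <= j < Q.2 ->
  area (at_pt pt) P Q != 0.
Proof.
move=> e hi hj; have h1 : P.1 <= Q.1 by lia.
have h2 : P.2 <= Q.2 by lia.
apply/eqP => /(boxsumP (at_pt_ge0 pt) h1 h2).2 /(_ i j hi hj).
by rewrite /at_pt e.
Qed.

Lemma residue_near (M : nat) (a b : int) : (0 < M)%N ->
  exists2 c, a <= c < a + M%:Z & (M%:Z %| c - b)%Z.
Proof.
move=> M0; exists (a + ((b - a) %% M%:Z)%Z).
  have := residue_bounds (b - a) M0; move: (_ %% _)%Z => r; lia.
have -> : a + ((b - a) %% M%:Z)%Z - b = - ((b - a) - ((b - a) %% M%:Z)%Z) by ring.
by rewrite rpredN {1}(divz_eq (b - a) M%:Z) addrK dvdz_mull.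
Qed.

Lemma mark_area_ge0 (m : 'I_n -> square n p) P Q : below P Q -> 0 <= mark_area m P Q.
Proof. by move=> h; apply: sumr_ge0 => l _; apply: area_ge0. Qed.

(* A rectangle of width or height at least pn contains a whole row or column. *)
Lemma mark_area0_small m P Q : one_per_row_and_column m -> below P Q ->
  mark_area m P Q = 0 -> small_rect P Q.
Proof.
move=> hm lPQ m0; have [_ hc hr] := transversal_mark hm.
have z l : area (at_pt (ptz (corner (m l)))) P Q = 0.
  move/eqP: m0; rewrite psumr_eq0; last by move=> i _; exact: area_ge0.
  by move/allP/(_ l (mem_index_enum _))/eqP.
case/andP: lPQ => l1 l2.
have ex_cg (f : 'I_n -> int) b : \sum_l (cg b (f l))%:R = 1 :> int -> exists l, cg b (f l).
  move=> e; case: (pickP (fun l => cg b (f l))) => [l hl|none]; first by exists l.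
  by move: e; rewrite big1 // => l _; rewrite none.
rewrite /small_rect !subr_gt0 l1 l2 /=; apply/andP; split; rewrite ltNge; apply/negP => h.
  have [l hl] := ex_cg (fun l => (corner (m l)).2%:Z) P.2 (hr P.2).
  have [u hu] := lattice_ex1 hl.
  have [c hc1 hc2] := residue_near P.1 ((corner (m l)).1%:Z + u) N_gt0.
  have e : eqpt (c, P.2) (ptz (corner (m l))).
    rewrite /eqpt /= -(latticeDr _ _ (latticeN hu)) subrr.
    by rewrite lattice_row -addrA -opprD.
  have := area_gt0 e (P := P) (Q := Q); rewrite z eqxx => /(_ _ _)/notF; apply=> /=; lia.
have [l hl] := ex_cg (fun l => (corner (m l)).1%:Z) P.1 (hc P.1).
have [u hu] := lattice_ex2 hl.
have [c hc1 hc2] := residue_near P.2 ((corner (m l)).2%:Z + u) N_gt0.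
have e : eqpt (P.1, c) (ptz (corner (m l))).
  rewrite /eqpt /= -(latticeDr _ _ (latticeN hu)) subrr.
  by rewrite lattice_col -addrA -opprD.
have := area_gt0 e (P := P) (Q := Q); rewrite z eqxx => /(_ _ _)/notF; apply=> /=; lia.
Qed.

(** * The involution on counted pairs *)

Section Differential.
Variable G : grid n p.

Lemma markX_area r : avoidsX q G r -> mark_area (markX G) (corner_ll r) (corner_ur r) = 0.
Proof.
move/forallP=> h; apply: big1 => l _; have := h l; rewrite -eqz_nat multE => /eqP h'; exact: h'.
Qed.

Lemma markX_areaP r : below (corner_ll r) (corner_ur r) ->
  mark_area (markX G) (corner_ll r) (corner_ur r) = 0 -> avoidsX q G r.
Proof.
move=> lr /eqP; rewrite psumr_eq0 => [/allP h|l _]; last exact: area_ge0.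
apply/forallP => l; have := h l (mem_index_enum _).
by rewrite -multE.
Qed.

Lemma markO_area r :
  mark_area (markO G) (corner_ll r) (corner_ur r) = \sum_l (mult q r (markO G l))%:Z.
Proof. by apply: eq_bigr => l _; rewrite multE. Qed.

Definition crossings (x y : gen n p) (P Q : int * int) : int :=
  interior_count (on x) P Q + interior_count (on y) P Q.

Lemma empty_rectE x y r : Rect q x y r ->
  empty_rect q x y r = (crossings x y (corner_ll r) (corner_ur r) == 0).
Proof.
move=> h; have /RectP[lr _ _ _ _] := h.
rewrite /empty_rect h /= !meets_interiorE // /crossings.
have := interior_count_ge0 (on x) lr; have := interior_count_ge0 (on y) lr.
move: (interior_count _ _ _) (interior_count _ _ _) => a b a0 b0.
by rewrite paddr_eq0.
Qed.

Lemma Maslov_rect x y r : Rect q x y r ->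
  Maslov q G x - Maslov q G y =
  (1 + crossings x y (corner_ll r) (corner_ur r)
   - 2 * mark_area (markO G) (corner_ll r) (corner_ur r))%:~R.
Proof.
case/RectP=> lr xP xQ ne yE.
rewrite (Maslov_swp G lr (small_rect_corners lr) xP xQ ne yE).
by congr (_%:~R); rewrite /crossings; ring.
Qed.

(* The drop in the Maslov grading from x to z bounds the crossings. *)
Lemma empty_pair x y z r1 r2 y' r1' r2' :
  empty_rect q x y r1 -> empty_rect q y z r2 ->
  Rect q x y' r1' -> Rect q y' z r2' ->
  (forall pt, quad_area (at_pt pt) (quad_of r1' r2') = quad_area (at_pt pt) (quad_of r1 r2)) ->
  empty_rect q x y' r1' /\ empty_rect q y' z r2'.
Proof.
move=> e1 e2 h1' h2' ar.
have /and3P[h1 _ _] := e1; have /and3P[h2 _ _] := e2.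
rewrite (empty_rectE h1) in e1; rewrite (empty_rectE h2) in e2.
rewrite (empty_rectE h1') (empty_rectE h2').
have arO : mark_area (markO G) (corner_ll r1') (corner_ur r1')
    + mark_area (markO G) (corner_ll r2') (corner_ur r2')
  = mark_area (markO G) (corner_ll r1) (corner_ur r1)
    + mark_area (markO G) (corner_ll r2) (corner_ur r2).
  by rewrite /mark_area -!big_split; apply: eq_bigr => l _; exact: ar.
have m1 := Maslov_rect h1; have m2 := Maslov_rect h2.
have m1' := Maslov_rect h1'; have m2' := Maslov_rect h2'.
have tot (a b c : rat) : (a - b) + (b - c) = a - c by ring.
have : (Maslov q G x - Maslov q G y) + (Maslov q G y - Maslov q G z)
     = (Maslov q G x - Maslov q G y') + (Maslov q G y' - Maslov q G z).
  by rewrite !tot.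
rewrite m1 m2 m1' m2' -!rmorphD /= => /eqP; rewrite eqr_int => /eqP.
rewrite (eqP e1) (eqP e2).
have /RectP[l1 _ _ _ _] := h1'; have /RectP[l2 _ _ _ _] := h2'.
have c1 : 0 <= crossings x y' (corner_ll r1') (corner_ur r1').
  by rewrite addr_ge0 // interior_count_ge0.
have c2 : 0 <= crossings y' z (corner_ll r2') (corner_ur r2').
  by rewrite addr_ge0 // interior_count_ge0.
move: c1 c2 arO; move: (crossings _ _ _ _) (crossings _ _ _ _).
move: (mark_area _ _ _) (mark_area _ _ _) (mark_area _ _ _) (mark_area _ _ _).
by clear => a b c d e f e0 f0 abcd h; split; lia.
Qed.

(** Placed end to end, the two rectangles would form a rectangle without X markings, hence with
    sides less than [pn]. But adding the equivalences [eA] and [eB] shows that one of its sides is a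
    positive multiple of [pn]. *)
Lemma not_annular s c : valid s c -> mark_area (markX G) c.1.1 c.1.2 = 0 ->
  mark_area (markX G) c.2.1 c.2.2 = 0 -> ~~ annular c.
Proof.
case: c => [[P Q] [A B]] [/= sP sQ nPQ lPQ sA sB nAB lAB] a1 a2.
have nQP : ~~ cg Q.2 P.2 by rewrite cg_sym.
have nBA : ~~ cg B.2 A.2 by rewrite cg_sym.
case/andP: (lPQ) => lPQ1 lPQ2; case/andP: (lAB) => lAB1 lAB2.
have moved X Y : eqpt (X, Y) A ->
    mark_area (markX G) (X, Y) (X + (B.1 - A.1), Y + (B.2 - A.2)) = 0.
  move=> e; rewrite -a2; apply: eq_bigr => l _.
  rewrite -(area_shift _ A B e) /shift /=; congr area; rewrite /=.
    by congr pair; ring.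
  by congr pair; ring.
apply/orP => -[/and3P[AP BQ /eqP e]|/and3P[AQ BP /eqP e]].
- have eA : eqpt (Q.1, P.2) A by move: sA; rewrite /swp AP eqpt_sym.
  have eB : eqpt B (P.1, Q.2).
    by move: sB; rewrite /swp BQ; case: ifP => // BP; rewrite -(cgr _ AP) (negbTE nBA) in BP.
  pose u := Q.1 + (B.1 - A.1) - P.1.
  have Nu : (N%:Z %| u)%Z.
    rewrite -lattice_row; have := latticeD eA eB => /=.
    congr (L _ _); rewrite /u; first by ring.
    by move: e; clear; lia.
  have lu : below P (P.1 + u, Q.2).
    by rewrite /below /u /=; move: lPQ1 lPQ2 lAB1; clear; lia.
  have : mark_area (markX G) P (P.1 + u, Q.2) = 0.
    have a12 := congr2 +%R a1 (moved _ _ eA); rewrite -[RHS](addr0 0) -[RHS]a12 -big_split.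
    apply: eq_bigr => l _; rewrite /area /=.
    have [g gE] := boxsum_potential (at_pt (ptz (corner (markX G l)))).
    rewrite e !gE /u.
    have -> : P.1 + (Q.1 + (B.1 - A.1) - P.1) = Q.1 + (B.1 - A.1) by ring.
    have -> : P.2 + (Q.2 - P.2) = Q.2 by ring.
    ring.
  move/(mark_area0_small (markX_rowcol G) lu)/andP=> [/= /andP[u0 uN] _].
  move: (dvd_lt Nu) u0 uN; rewrite (addrC P.1) addrK; move: (N%:Z) (u) => M u'.
  by clear; lia.
have eA : eqpt (P.1, Q.2) A.
  by move: sA; rewrite /swp AQ; case: ifP => [AP|_]; rewrite eqpt_sym // -(cgl _ AP) in nPQ *; rewrite AQ in nPQ.
have eB : eqpt B (Q.1, P.2) by move: sB; rewrite /swp BP.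
pose v := Q.2 + (B.2 - A.2) - P.2.
have Nv : (N%:Z %| v)%Z.
  rewrite -lattice_col; have := latticeD eA eB => /=.
  congr (L _ _); rewrite /v; last by ring.
  by move: e; clear; lia.
have lv : below P (Q.1, P.2 + v).
  by rewrite /below /v /=; move: lPQ1 lPQ2 lAB2; clear; lia.
have : mark_area (markX G) P (Q.1, P.2 + v) = 0.
  have a12 := congr2 +%R a1 (moved _ _ eA); rewrite -[RHS](addr0 0) -[RHS]a12 -big_split.
  apply: eq_bigr => l _; rewrite /area /=.
  have [g gE] := boxsum_potential (at_pt (ptz (corner (markX G l)))).
  rewrite e !gE /v.
  have -> : P.2 + (Q.2 + (B.2 - A.2) - P.2) = Q.2 + (B.2 - A.2) by ring.
  have -> : P.1 + (Q.1 - P.1) = Q.1 by ring.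
  ring.
move/(mark_area0_small (markX_rowcol G) lv)/andP=> [_ /= /andP[v0 vN]].
move: (dvd_lt Nv) v0 vN; rewrite (addrC P.2) addrK; move: (N%:Z) (v) => M v'.
by clear; lia.
Qed.

Definition counted (x y : gen n p) (r : rect n p) := empty_rect q x y r && avoidsX q G r.

Definition chain : Type := ((gen n p * rect n p) * (gen n p * rect n p))%type.

Definition counted_chain (x : gen n p) (t : chain) : bool :=
  counted x t.1.1 t.1.2 && counted t.1.1 t.2.1 t.2.2.

(** The middle generator is determined by [x] and the new first rectangle, so only the rectangles
    have to be exchanged. *)
Definition switch (x : gen n p) (t : chain) : chain :=
  let: ((_, r1), (z, r2)) := t in
  let: (r1', r2') := mkrects (exchange (quad_of r1 r2)) in
  ((rect_target x r1', r1'), (z, r2')).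

Lemma switchE x y z r1 r2 r1' r2' : mkrects (exchange (quad_of r1 r2)) = (r1', r2') ->
  switch x ((y, r1), (z, r2)) = ((rect_target x r1', r1'), (z, r2')).
Proof. by rewrite /switch => ->. Qed.

Lemma switch_target x t : (switch x t).2.1 = t.2.1.
Proof. by case: t => [[y r1] [z r2]]; rewrite /switch; case: (mkrects _). Qed.

(** The X multiplicities of the new rectangles are nonnegative with sum 0, so they vanish. This
    bounds the sides by [pn], hence normal forms exist and involutivity up to translation becomes an
    equality of chains. *)
Lemma switchP x t : counted_chain x t ->
  [/\ counted_chain x (switch x t), switch x (switch x t) = t, switch x t != t &
      forall pt, quad_area (at_pt pt) (quad_of (switch x t).1.2 (switch x t).2.2)
               = quad_area (at_pt pt) (quad_of t.1.2 t.2.2)].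
Proof.
case: t => [[y r1] [z r2]] ht.
have [e1 X1 e2 X2] : [/\ empty_rect q x y r1, avoidsX q G r1,
    empty_rect q y z r2 & avoidsX q G r2].
  by case/andP: ht => /andP[h1 h2] /andP[h3 h4].
have /and3P[h1 _ _] := e1; have /and3P[h2 _ _] := e2.
have [vc zE] := Rect_valid h1 h2.
have X1' := markX_area X1; have X2' := markX_area X2.
have [d [vd dT dA psi1 psi2 neq]] :=
  exists_switched (on_state x) vc (not_annular vc X1' X2').
have dX : mark_area (markX G) d.1.1 d.1.2 + mark_area (markX G) d.2.1 d.2.2 = 0.
  rewrite -[RHS](addr0 0) -[RHS](congr2 +%R X1' X2') /mark_area -!big_split.
  by apply: eq_bigr => l _; exact: dA.
have dX0 : mark_area (markX G) d.1.1 d.1.2 = 0 /\ mark_area (markX G) d.2.1 d.2.2 = 0.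
  have := mark_area_ge0 (markX G) (valid_below1 vd).
  have := mark_area_ge0 (markX G) (valid_below2 vd); move: dX.
  by move: (mark_area _ _ _) (mark_area _ _ _); clear => a b; lia.
have sd : small_quad d.
  apply/andP; split.
    exact: mark_area0_small (markX_rowcol G) (valid_below1 vd) dX0.1.
  exact: mark_area0_small (markX_rowcol G) (valid_below2 vd) dX0.2.
set c := quad_of r1 r2 in psi1 psi2 vc zE dT dA neq *.
case E : (mkrects (exchange c)) => [r1' r2'].
have same0 : same_quad (quad_of r1' r2') d.
  have := @quad_of_mkrects (exchange c); rewrite E => same0.
  apply: (same_quad_trans _ psi1); apply: same0.
  by rewrite (small_quad_same psi1).
have vd' := valid_same (on_state x) (same_quad_sym same0) vd.
have zE' T : on z T = target (on x) (quad_of r1' r2') T.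
  by rewrite zE -dT (target_same _ _ same0).
have [y' [h1' h2']] := valid_Rect vd' zE'.
have ar pt : quad_area (at_pt pt) (quad_of r1' r2') = quad_area (at_pt pt) c.
  by rewrite (quad_area_same _ same0) dA.
have [e1' e2'] := empty_pair e1 e2 h1' h2' ar.
have arX : mark_area (markX G) (corner_ll r1') (corner_ur r1')
  + mark_area (markX G) (corner_ll r2') (corner_ur r2') = 0.
  rewrite -dX /mark_area -!big_split; apply: eq_bigr => l _.
  exact: (quad_area_same _ same0).
have [l1 l2] := (valid_below1 vd', valid_below2 vd').
have arX0 : mark_area (markX G) (corner_ll r1') (corner_ur r1') = 0 /\
    mark_area (markX G) (corner_ll r2') (corner_ur r2') = 0.
  have := mark_area_ge0 (markX G) l1; have := mark_area_ge0 (markX G) l2; move: arX.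
  by move: (mark_area _ _ _) (mark_area _ _ _); clear => a b; lia.
have back : mkrects (exchange (quad_of r1' r2')) = (r1, r2).
  have same1 : same_quad (exchange (quad_of r1' r2')) c.
    exact: same_quad_trans (exchange_same same0) psi2.
  rewrite [LHS]surjective_pairing; apply: quad_of_inj.
  apply: (same_quad_trans _ same1); apply: quad_of_mkrects.
  rewrite (small_quad_same same1); apply/andP.
  by split; apply: small_rect_corners; [exact: valid_below1 vc|exact: valid_below2 vc].
rewrite !(switchE x _ z E) !(switchE x _ z back) (rect_targetE h1) (rect_targetE h1').
split=> //.
  rewrite /counted_chain /counted /= e1' e2'.
  by rewrite (markX_areaP l1 arX0.1) (markX_areaP l2 arX0.2).
(* A fixed chain would have its old and new quads equal up to translation. *)
apply/eqP => -[_ r11 r22]; apply: neq; rewrite /c -r11 -r22.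
exact: same0.
Qed.

(** * Square and degree of the differential *)

Section Coefficients.
Variables (K : comNzRingType) (V : 'I_n -> K).

Definition weight (r : rect n p) : K := \prod_(i < n) V i ^+ mult q r (markO G i).

Lemma bdry_genE x : bdry_gen q G V x =
  \sum_(yr : gen n p * rect n p | counted x yr.1 yr.2) weight yr.2 *: gen_elt K yr.1.
Proof. by rewrite /bdry_gen pair_big_dep. Qed.

Lemma weight_quad r1 r2 r1' r2' :
  (forall pt, quad_area (at_pt pt) (quad_of r1' r2') = quad_area (at_pt pt) (quad_of r1 r2)) ->
  weight r1' * weight r2' = weight r1 * weight r2.
Proof.
move=> h; rewrite /weight -!big_split; apply: eq_bigr => i _ /=; rewrite -!exprD.
congr (_ ^+ _); apply/eqP; rewrite -eqz_nat !PoszD !multE; apply/eqP; exact: h.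
Qed.

Lemma bdry_bdry (K2 : forall k : K, k + k = 0) (c : GC n p K) :
  bdry q G V (bdry q G V c) = 0.
Proof.
suff h x : bdry q G V (bdry_gen q G V x) = 0.
  rewrite {2}/bdry linear_sum big1 // => x _.
  by rewrite linearZ /= h scaler0.
rewrite bdry_genE linear_sum /=.
under eq_bigr => yr _ do rewrite linearZ /= bdryE bdry_genE scaler_sumr.
rewrite pair_big_dep /=.
apply: (sum_involution_char2 (phi := switch x)).
- by move=> v; apply/ffunP => z; rewrite !ffunE; exact: K2.
- by move=> t /switchP[].
- by move=> t /switchP[].
- by move=> t /switchP[].
move=> t /switchP[_ _ _ h]; rewrite !scalerA (weight_quad h).
by rewrite switch_target.
Qed.

(** A counted rectangle has no crossings and no X, so $M(x)-M(y)=1-2d$ and $A(x)-A(y)=-d$, where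
    [d], its number of O markings, is the degree of its monomial. *)
Lemma bdry_homogeneous x :
  homogeneous q G V (Maslov q G x - 1, Alexander q G x, Spin q G x)
    (bdry q G V (gen_elt K x)).
Proof.
pose f (yr : gen n p * rect n p) : 'X_{1..n} * gen n p :=
  ([multinom mult q yr.2 (markO G i) | i < n], yr.1).
exists [seq f yr | yr <- index_enum _ & counted x yr.1 yr.2].
  move=> my /mapP[[y r]]; rewrite mem_filter => /andP[/andP[/= e X] _] ->.
  have /and3P[h _ _] := e; rewrite (empty_rectE h) in e.
  have := Maslov_rect h; rewrite (eqP e) addr0 => hM.
  have /RectP[lr xP xQ ne yE] := h.
  have := Alexander_swp G xP xQ ne yE; rewrite (markX_area X) sub0r => hA.
  have deg : (mdeg (f (y, r)).1)%:R
      = (mark_area (markO G) (corner_ll r) (corner_ur r))%:~R :> rat.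
    rewrite markO_area mdegE natr_sum rmorph_sum; apply: eq_bigr => i _.
    by rewrite mnmE.
  rewrite /tridegree deg -(Spin_swp G xP xQ ne yE); congr (_, _, _).
    by move: hM; rewrite rmorphB rmorphM /=; lra.
  by move: hA; rewrite rmorphN /=; lra.
rewrite bdryE bdry_genE big_map big_filter; apply: eq_bigr => yr _.
by congr (_ *: _); apply: eq_bigr => i _; rewrite mnmE.
Qed.

End Coefficients.
End Differential.
End Lattice.

(** * The two coefficient rings have characteristic 2 *)

Lemma mpolyF2_addrr n (f : Rminus n) : f + f = 0.
Proof.
have two0 : 2%:R = 0 :> 'F_2 by apply/eqP.
by rewrite -mulr2n -(scaler_nat 2 (f : {mpoly 'F_2[n]})) two0 scale0r.
Qed.

Lemma Rhat_addrr n (i : 'I_n) (a : Rhat i) : a + a = 0.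
Proof.
by rewrite -[a]reprK -rmorphD mpolyF2_addrr rmorph0.
Qed.

Theorem proposition2p11 (n p q : nat) (hn : (0 < n)%N) (hpq : lens_params p q)
    (G : grid n p) (hG : represents_knot G) :
  let i1 : 'I_n := Ordinal hn in
  [/\ forall c : GC n p (Rminus n),
        bdry q G (@Vminus n) (bdry q G (@Vminus n) c) = 0,
      forall c : GC n p (Rhat i1),
        bdry q G (Vhat i1) (bdry q G (Vhat i1) c) = 0,
      forall x : gen n p,
        homogeneous q G (@Vminus n)
          (Maslov q G x - 1, Alexander q G x, Spin q G x)
          (bdry q G (@Vminus n) (gen_elt (Rminus n) x)) &
      forall x : gen n p,
        homogeneous q G (Vhat i1)
          (Maslov q G x - 1, Alexander q G x, Spin q G x)
          (bdry q G (Vhat i1) (gen_elt (Rhat i1) x))].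
Proof.
move=> i1; have [cop p_cases] := hpq.
have hp : (0 < p)%N by case: p_cases => [|[-> _]] //; case/andP=> h1 h2; exact: leq_trans h2.
split=> [c|c|x|x].
- exact: (bdry_bdry hn hp cop _ _ (@mpolyF2_addrr n)).
- exact: (bdry_bdry hn hp cop _ _ (@Rhat_addrr n i1)).
- exact: (bdry_homogeneous hn hp cop).
exact: (bdry_homogeneous hn hp cop).
Qed.
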